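(* Let $f$ be a positive integer and for non-negative integers $n_1,\dots,n_f$ put $N_i:=n_i+n_{i+1}+\dots+n_f$ for $i=1,\dots,f$. Then for $|q|<1$, \[ \sum_{m,n,n_1,\dots,n_f\geq 0}\frac{q^{2m^2+6mn+6n^2+3(N_1^2+\dots+N_f^2)}(q^3;q^3)_{n_f}}{(q;q)_m(q^3;q^3)_n(q^3;q^3)_{n_f-2n-m}(q^3;q^3)_{n_1}\cdots(q^3;q^3)_{n_{f-1}}(q^3;q^3)_{2n_f}}=\frac{(q^{6f+6},-q^{3f+2},-q^{3f+4};q^{6f+6})_\infty}{(q^3;q^3)_\infty}. \]
   Context: $(a;p)_n=\prod_{k=0}^{n-1}(1-ap^k)$ for a base $p$, $(a_1,\dots,a_k;p)_n=(a_1;p)_n\cdots(a_k;p)_n$, and for $|p|<1$, $(a;p)_\infty=\lim_{n\to\infty}(a;p)_n$. By convention $1/(q^3;q^3)_n=0$ for negative integers $n$, so summands with $n_f-2n-m<0$ vanish. *)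

(* Defs.v *)
From mathcomp Require Import all_boot all_order all_algebra finmap.
From mathcomp Require Import all_classical reals topology normedtype sequences.
From mathcomp.analysis.showcase Require Import summability.

Set Implicit Arguments.
Unset Strict Implicit.
Unset Printing Implicit Defensive.

Import Order.TTheory GRing.Theory Num.Theory.
Import numFieldNormedType.Exports.

Local Open Scope ring_scope.
Local Open Scope classical_set_scope.

Definition qpoch (K : comPzRingType) (a p : K) (n : nat) : K :=
  \prod_(k < n) (1 - a * p ^+ k).

(* 1/(a;p)_z, with the convention that it vanishes for negative z *)
Definition qpochV (K : fieldType) (a p : K) (z : int) : K :=
  match z with
  | Posz n => (qpoch a p n)^-1
  | Negz _ => 0
  end.

Definition qpoch_inf (K : numFieldType) (a p : K) : K :=
  lim (qpoch a p n @[n --> \oo]).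

(* (a_1, ..., a_k; p)_oo *)
Definition qpochs_inf (K : numFieldType) (s : seq K) (p : K) : K :=
  \prod_(a <- s) qpoch_inf a p.

(* Unordered summation: convergence along the net of finite index subsets,
   which over the complex numbers amounts to absolute convergence. *)
Definition has_sum (K : numFieldType) (I : choiceType) (u : I -> K)
    (s : K) : Prop :=
  partial_sum u @ totally --> s.

Section Summand.
Variables (f : nat) (ns : f.-tuple nat).

(* 1-based entries: ns = (n_1, ..., n_f) *)
Definition entry (i : nat) : nat := nth 0%N ns i.-1.

Definition tail_sum (i : nat) : nat := (\sum_(i <= j < f.+1) entry j)%N.

Definition summand (K : fieldType) (q : K) (m n : nat) : K :=
  q ^+ (2 * m ^ 2 + 6 * m * n + 6 * n ^ 2
        + 3 * \sum_(1 <= i < f.+1) tail_sum i ^ 2)%N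
  * qpoch (q ^+ 3) (q ^+ 3) (entry f)
  * qpochV (q ^+ 3) (q ^+ 3) ((entry f)%:Z - 2 * n%:Z - m%:Z)
  / (qpoch q q m
     * qpoch (q ^+ 3) (q ^+ 3) n
     * (\prod_(1 <= i < f) qpoch (q ^+ 3) (q ^+ 3) (entry i))
     * qpoch (q ^+ 3) (q ^+ 3) (2 * entry f)%N).

End Summand.

(* Main.v *)
Require Import Defs.
From mathcomp Require Import all_boot all_order all_algebra finmap.
From mathcomp Require Import all_classical reals complex topology normedtype sequences.
From mathcomp.analysis.showcase Require Import summability.
From mathcomp Require Import ring zify.

(* Write p = q^3. For a fixed last entry N = n_f, the sum over m and n is the N-th
   coefficient of F(z) / (z; p)_oo, where
   F(z) = sum_{m,n} q^(2m^2+6mn+6n^2) z^(m+2n) / ((q; q)_m (p; p)_n).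
   Completing the square, 2m^2+6mn+6n^2 = (3s^2 + m^2)/2 with s = m+2n, so up to
   the factors q^(3s^2/2) the coefficients of F are those of the infinite product
   (-z q^(1/2); q)_oo / (z^2; p)_oo. The resulting q-difference equation gives a
   three-term recurrence in N, which is the one satisfied by the even
   Stieltjes-Wigert polynomials. Hence
     (p; p)_N / (p; p)_2N * (sum over m and n)
       = sum_r q^(3r^2+r) / ((p; p)_(N-r) (p; p)_(N+r)),
   a Bailey pair relative to a = 1. Iterating Bailey's lemma f times and letting
   the truncation go to infinity turns the left-hand side into
   1/(p; p)_oo * sum_r q^((3f+3)r^2+r), which is the right-hand side by the Jacobi
   triple product. The terms are bounded in modulus by the terms for |q|, which
   are nonnegative, so the same evaluation at |q| gives absolute convergence. *)

Set Implicit Arguments.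
Unset Strict Implicit.
Unset Printing Implicit Defensive.

Import Order.TTheory GRing.Theory Num.Theory.
Import numFieldNormedType.Exports.

Local Open Scope ring_scope.
Local Open Scope classical_set_scope.

(** * Formal power series as sequences *)

Section Sequences.
Variable K : fieldType.
Implicit Types (a b c : nat -> K) (x y : K).

(* A sequence stands for its generating function: [conv] is the product, [back k]
   multiplication by z^k and [scl x] the substitution z -> x z. *)
Definition conv a b n : K := \sum_(i < n.+1) a i * b (n - i)%N.

Definition back k a n : K := if (k <= n)%N then a (n - k)%N else 0.

Definition scl x a n : K := x ^+ n * a n.

Lemma back0 a n : back 0 a n = a n.
Proof. by rewrite /back subn0. Qed.

Lemma back_lt k a n : (n < k)%N -> back k a n = 0.
Proof. by rewrite ltnNge /back => /negbTE ->. Qed.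

Lemma backD k a n : back k a (k + n) = a n.
Proof. by rewrite /back leq_addr addKn. Qed.

Lemma back_back j k a n : back j (back k a) n = back (j + k) a n.
Proof.
have [lt_nj|le_jn] := ltnP n j; first by rewrite !back_lt ?ltn_addr.
rewrite -(subnKC le_jn); move: (n - j)%N => m; rewrite backD.
have [lt_mk|le_km] := ltnP m k; first by rewrite !back_lt ?ltn_add2l.
by rewrite -(subnKC le_km) addnA !backD.
Qed.

Lemma eq_back k a b n : a =1 b -> back k a n = back k b n.
Proof. by move=> eq_ab; rewrite /back eq_ab. Qed.

(** Functional equations are kept in the shape A(z) = B(z) + x z^k C(z); this lemma and the other
    [_lin] ones carry them through shifts, products and dilations. *)
Lemma back_lin j k a b c x n : (forall i, a i = b i + x * back k c i) ->
  back j a n = back j b n + x * back (k + j) c n.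
Proof.
move=> E; rewrite addnC -back_back /back; case: ifP => _; first exact: E.
by rewrite mulr0 addr0.
Qed.

Lemma eq_conv a a' b b' n : a =1 a' -> b =1 b' -> conv a b n = conv a' b' n.
Proof. by move=> Ea Eb; apply: eq_bigr => i _; rewrite Ea Eb. Qed.

Lemma convC a b n : conv a b n = conv b a n.
Proof.
rewrite /conv (reindex_inj rev_ord_inj) /=; apply: eq_bigr => i _.
by rewrite subSS subKn ?leq_ord // mulrC.
Qed.

Lemma conv_back k a b n : conv (back k a) b n = back k (conv a b) n.
Proof.
rewrite /conv; have [lt_nk|le_kn] := ltnP n k.
  rewrite back_lt // big1 // => i _.
  by rewrite back_lt ?mul0r // (leq_ltn_trans (leq_ord i)).
rewrite -(subnKC le_kn); move: (n - k)%N => m; rewrite backD -addnS big_split_ord /=.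
rewrite big1 ?add0r => [|i _]; last by rewrite back_lt ?mul0r.
by apply: eq_bigr => i _; rewrite backD subnDl.
Qed.

Lemma conv_lin k a b c e x n : (forall i, a i = b i + x * back k c i) ->
  conv a e n = conv b e n + x * back k (conv c e) n.
Proof.
move=> E; rewrite -conv_back /conv mulr_sumr -big_split /=.
by apply: eq_bigr => i _; rewrite E mulrDl mulrA.
Qed.

Lemma conv_linr k a b c e x n : (forall i, a i = b i + x * back k c i) ->
  conv e a n = conv e b n + x * back k (conv e c) n.
Proof.
move=> E; rewrite convC (conv_lin _ _ E) convC; congr (_ + x * _).
by apply: eq_back => i; rewrite convC.
Qed.

Lemma scl_conv x a b n : scl x (conv a b) n = conv (scl x a) (scl x b) n.
Proof.
rewrite /scl /conv mulr_sumr; apply: eq_bigr => i _.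
by rewrite mulrACA -exprD subnKC // leq_ord.
Qed.

Lemma scl_scl x y a n : scl x (scl y a) n = scl (x * y) a n.
Proof. by rewrite /scl mulrA -exprMn. Qed.

Lemma scl_back x k a n : scl x (back k a) n = x ^+ k * back k (scl x a) n.
Proof.
rewrite /scl; have [lt_nk|le_kn] := ltnP n k; first by rewrite !back_lt ?mulr0.
by rewrite -(subnKC le_kn) !backD exprD mulrA.
Qed.

Lemma scl_lin x y k a b c n : (forall i, a i = b i + x * back k c i) ->
  scl y a n = scl y b n + x * y ^+ k * back k (scl y c) n.
Proof.
by move=> E; rewrite -mulrA -scl_back /scl E mulrDr mulrCA.
Qed.

(** Since n^2 = k^2 + 2k(n-k) + (n-k)^2, a Gaussian factor x^(n^2) couples the shift by z^k with the
    dilation z -> x^(2k) z. *)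
Lemma gauss_back x k a n :
  x ^+ (n ^ 2) * back k a n =
  x ^+ (k ^ 2) * back k (scl (x ^+ (2 * k)) (fun i => x ^+ (i ^ 2) * a i)) n.
Proof.
have [lt_nk|le_kn] := ltnP n k; first by rewrite !back_lt ?mulr0.
rewrite -(subnKC le_kn) !backD /scl -exprM !mulrA -!exprD; congr (_ ^+ _ * _).
by lia.
Qed.

End Sequences.

(** * q-Pochhammer symbols and two q-summation formulas *)

Section QPoch.
Variable K : fieldType.
Implicit Types (p x y : K).

Lemma qpochS (a p : K) n : qpoch a p n.+1 = qpoch a p n * (1 - a * p ^+ n).
Proof. exact: big_ord_recr. Qed.

Lemma qpoch0 (a p : K) : qpoch a p 0 = 1.
Proof. exact: big_ord0. Qed.

Definition qfac p n : K := (qpoch p p n)^-1.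

Definition nonunity p := forall n, 1 - p ^+ n.+1 != 0.

Lemma nonunityX p k : (0 < k)%N -> nonunity p -> nonunity (p ^+ k).
Proof.
by move=> k0 np n; rewrite -exprM -[(k * _)%N]prednK ?np // muln_gt0 k0.
Qed.

Lemma qpoch_neq0 p n : nonunity p -> qpoch p p n != 0.
Proof. by move=> np; apply/prodf_neq0 => i _; rewrite -exprS. Qed.

Lemma qfac0 p : qfac p 0 = 1.
Proof. by rewrite /qfac qpoch0 invr1. Qed.

Lemma qfacS p n : nonunity p -> (1 - p ^+ n.+1) * qfac p n.+1 = qfac p n.
Proof. by move=> np; rewrite /qfac qpochS -exprS invfM mulrCA divff ?mulr1. Qed.

(** With E(z) = 1/(z; p)_oo this is (1 - z) E(z) = E(pz). The explicit factor 1 fits the shape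
    expected by [conv_linr]. *)
Lemma qfac_fe p n : nonunity p ->
  qfac p n = scl p (qfac p) n + 1 * back 1 (qfac p) n.
Proof.
move=> np; rewrite /scl mul1r; case: n => [|n]; first by rewrite mul1r back_lt ?addr0.
by rewrite (backD 1 _ n) -(qfacS n np); ring.
Qed.

(* Coefficients of (-x z; p)_oo / (y z; p)_oo. *)
Lemma q_binomial p x y n : nonunity p ->
  conv (fun i => x ^+ i * p ^+ 'C(i, 2) * qfac p i) (fun j => y ^+ j * qfac p j) n
  = (\prod_(j < n) (y + x * p ^+ j)) * qfac p n.
Proof.
move=> np.
pose a i := x ^+ i * p ^+ 'C(i, 2) * qfac p i.
pose b j := y ^+ j * qfac p j.
have aE i : a i = scl p a i + x * back 1 (scl p a) i.
  rewrite /a /scl; case: i => [|i]; first by rewrite back_lt // mulr0 addr0 !expr0 !mul1r.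
  rewrite (backD 1 _ i) -(qfacS i np) binS bin1 !exprD !exprS; ring.
have bE i : b i = scl p b i + y * back 1 b i.
  rewrite /b /scl; case: i => [|i]; first by rewrite back_lt // mulr0 addr0 !expr0 !mul1r.
  rewrite (backD 1 _ i) -(qfacS i np) !exprS; ring.
rewrite -/a -/b; elim: n => [|n IHn].
  by rewrite /conv big_ord_recl !big_ord0 /a /b qfac0 !expr0 !mulr1 addr0.
(* As series, G(z) = (1 + xz) U(z) and U(z) = G(pz) + yz U(z). Index n+1 gives (1 - p^(n+1)) g_(n+1)
   = (x + y) u_n, and index n gives (y + x p^n) g_n = (x + y) u_n. *)
pose g := conv a b; pose u := conv (scl p a) b.
have gu i : g i = u i + x * back 1 u i by exact: conv_lin.
have us i : u i = scl p g i + y * back 1 u i.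
  by rewrite scl_conv /u; apply: conv_linr.
have {}gu := gu n.+1; have g0 : g n = u n + x * back 1 u n by exact: conv_lin.
have us1 := us n.+1; have us0 := us n.
rewrite !(backD 1 _ n) /scl in gu us1 us0.
apply: (mulfI (np n)); rewrite big_ord_recr /=.
have -> : (1 - p ^+ n.+1) * (\prod_(i < n) (y + x * p ^+ i) * (y + x * p ^+ n) * qfac p n.+1)
   = (y + x * p ^+ n) * g n by rewrite /g IHn -(qfacS n np); ring.
rewrite -/g.
have -> : (1 - p ^+ n.+1) * g n.+1 = (x + y) * u n by rewrite mulrBl mul1r {1}gu us1; ring.
rewrite /scl in us0.
have E : u n = p ^+ n * g n + y * back 1 u n by [].
have E2 : y * g n - y * u n = x * (u n - p ^+ n * g n) by rewrite g0 {3}E g0; ring.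
have -> : (y + x * p ^+ n) * g n = y * g n - x * (u n - p ^+ n * g n) + x * u n by ring.
by rewrite -E2; ring.
Qed.

(** A limiting q-Vandermonde sum (Durfee rectangles), the engine of Bailey's lemma. Both sides obey
    (1 - p^(n+1)) (1 - p^(n+m+1)) y_(n+1) = y_n. *)
Lemma durfee_sum p m n : nonunity p ->
  conv (fun i => p ^+ (i ^ 2 + m * i) * qfac p i * qfac p (i + m)) (qfac p) n
  = qfac p n * qfac p (n + m).
Proof.
move=> np.
pose j i := p ^+ (i ^ 2 + m * i) * qfac p i * qfac p (i + m).
pose y0 := conv j (qfac p).
pose y1 := conv (scl p j) (qfac p).
pose y2 := conv (scl p (scl p j)) (qfac p).
have iotaE := fun i => qfac_fe i np.
have y01 i : y1 i = scl p y0 i + 1 * back 1 y1 i.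
  by rewrite scl_conv; apply: conv_linr.
have y12 i : y2 i = scl p y1 i + 1 * back 1 y2 i.
  by rewrite scl_conv; apply: conv_linr.
(* Second-order q-difference equation, equivalent to (1 - p^i) (1 - p^(i+m)) j_i = p^(2i+m-1)
   j_(i-1). *)
have jE i : j i = ((1 + p ^+ m) * scl p j i - p ^+ m * scl p (scl p j) i)
    + p ^+ m.+1 * back 1 (scl p (scl p j)) i.
  rewrite /scl; case: i => [|i].
    by rewrite back_lt // mulr0 !expr0 !mul1r; ring.
  rewrite (backD 1 _ i) /j addSn -(qfacS i np) -(qfacS (i + m) np).
  have -> : (i.+1 ^ 2 + m * i.+1 = i ^ 2 + m * i + i + i + m + 1)%N by lia.
  by rewrite !(exprD, exprS); ring.
have y0E i : y0 i = ((1 + p ^+ m) * y1 i - p ^+ m * y2 i) + p ^+ m.+1 * back 1 y2 i.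
  rewrite /y0 (conv_lin _ _ jE); congr (_ + _).
  rewrite /y1 /y2 /conv !mulr_sumr -sumrB; apply: eq_bigr => k _; ring.
rewrite -/j -/y0; elim: n => [|n IHn].
  rewrite /y0 /conv big_ord_recl big_ord0 /j !qfac0 !add0n muln0 expr0; ring.
have E1 := y01 n.+1; have E2 := y12 n.+1; have E0 := y0E n.+1; have E0' := y0E n.
have E1' := y01 n; have E2' := y12 n.
rewrite !(backD 1 _ n) /scl in E0 E1 E2.
rewrite /scl in E1' E2'.
apply: (mulfI (np n)); apply: (mulfI (np (n + m)%N)).
have -> : (1 - p ^+ (n + m).+1) * ((1 - p ^+ n.+1) * (qfac p n.+1 * qfac p (n.+1 + m)))
  = y0 n by rewrite IHn addSn -(qfacS n np) -(qfacS (n + m) np); ring.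
have -> : (1 - p ^+ (n + m).+1) * ((1 - p ^+ n.+1) * y0 n.+1) =
   y0 n.+1 - (1 + p ^+ m) * (p ^+ n.+1 * y0 n.+1)
   + p ^+ m * p ^+ n.+1 * (p ^+ n.+1 * y0 n.+1) by rewrite !exprS exprD; ring.
have -> : p ^+ n.+1 * y0 n.+1 = y1 n.+1 - y1 n by rewrite {1}E1; ring.
have -> : p ^+ m * p ^+ n.+1 * (y1 n.+1 - y1 n) =
   p ^+ m * ((y2 n.+1 - y2 n) - p * (y2 n - back 1 y2 n)).
  have -> : y2 n - back 1 y2 n = p ^+ n * y1 n by rewrite {1}E2'; ring.
  by rewrite E2 exprS; ring.
by rewrite E0 E0' exprS; ring.
Qed.

End QPoch.

(** * The Bailey pair *)

Section Capparelli.
Variables (K : fieldType) (r : K).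
Hypothesis nr : nonunity r.
Let q := r ^+ 2.
Let p := r ^+ 6.
(** A square root of p: it supplies the q^(3s^2/2) of the completed square, and z -> wz removes the
    first factor of (z^2; p)_oo. *)
Let w := r ^+ 3.

Let nq : nonunity q. Proof. exact: nonunityX. Qed.
Let np : nonunity p. Proof. exact: nonunityX. Qed.

(* With q = r^2 and p = r^6, [cap_odd] and [cap_even] are the coefficients of
   (-r z; q)_oo and 1/(z^2; p)_oo, and [cap s] is the sum over m + 2n = s of
   q^(2m^2+6mn+6n^2) / ((q; q)_m (p; p)_n). *)
Definition cap_odd m : K := r ^+ (m ^ 2) * qfac (r ^+ 2) m.

Definition cap_even n : K := if odd n then 0 else qfac (r ^+ 6) n./2.

Definition cap s : K := (r ^+ 3) ^+ (s ^ 2) * conv cap_odd cap_even s.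

Definition cap_sum : nat -> K := conv cap (qfac (r ^+ 6)).

Let g := conv cap_odd cap_even.

Lemma cap_odd_fe m :
  cap_odd m = scl q cap_odd m + r * back 1 (scl q cap_odd) m.
Proof.
rewrite /cap_odd /scl -/q; case: m => [|m].
  by rewrite back_lt // mulr0 addr0 !expr0 !mul1r.
rewrite (backD 1 _ m) -(qfacS m nq).
have -> : (m.+1 ^ 2 = m ^ 2 + m + m + 1)%N by lia.
by rewrite !exprD /q -!exprM !mulSn !mul0n !exprD; ring.
Qed.

Lemma cap_even_fe n :
  cap_even n = scl w cap_even n + 1 * back 2 cap_even n.
Proof.
rewrite /cap_even /scl -/p; case: n => [|[|n]].
- by rewrite back_lt // mulr0 addr0 expr0 mul1r.
- by rewrite back_lt // !mulr0 addr0.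
rewrite (backD 2 _ n) /= negbK; case: ifP => [_|en]; first by rewrite !mulr0 addr0.
rewrite -(qfacS n./2 np) -[in w ^+ _](odd_double_half n) en /= add0n -doubleS.
have -> : w ^+ (n./2.+1).*2 = p ^+ (n./2.+1).
  by rewrite /w /p -!exprM; congr (r ^+ _); lia.
ring.
Qed.

(* Everything is written in terms of u 3, the coefficients of
   (-r q^3 z; q)_oo / (p z^2; p)_oo: the common factor 1 + r^3 z of both sides of
   the q-difference equation then never has to be divided out. *)
Lemma cap_gf_fe n : g n = scl p g n + w * back 1 g n
  + (r + r ^+ 5) * back 1 (scl p g) n + back 2 g n
  + p * back 2 (scl p g) n - w * back 3 g n.
Proof.
(* In closed form the goal is (1 - wz) (1 - z^2) G(z) = (1 + rz) (1 + r^5 z) G(pz). As p = q^3,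
   three uses of [cap_odd_fe] lead from [u 0] to [u 3]. *)
pose u i := conv (scl (q ^+ i) cap_odd) (scl w cap_even).
have oddE i m : scl (q ^+ i) cap_odd m =
    scl (q ^+ i.+1) cap_odd m + r * q ^+ i * back 1 (scl (q ^+ i.+1) cap_odd) m.
  rewrite (scl_lin _ _ cap_odd_fe) expr1 scl_scl -exprSr; congr (_ + _ * _).
  by apply: eq_back => k; rewrite scl_scl -exprSr.
have uE i m : u i m = u i.+1 m + r * q ^+ i * back 1 (u i.+1) m.
  exact: conv_lin (oddE i).
have gE m : g m = u 0 m + 1 * back 2 g m.
  rewrite [LHS](conv_linr _ _ cap_even_fe); congr (_ + _).
  by apply: eq_conv => // k; rewrite /scl expr1n mul1r.
have ME m : u 3 m = scl p g m + p * back 2 (u 3) m.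
  have evenE k : scl w cap_even k = scl p cap_even k + p * back 2 (scl w cap_even) k.
    rewrite (scl_lin _ _ cap_even_fe) scl_scl /p /w -!exprD mul1r.
    by rewrite -exprM.
  rewrite [LHS](conv_linr _ _ evenE); congr (_ + _).
  by rewrite scl_conv; apply: eq_conv => // k; rewrite /p /q -exprM.
have gB k : back k g n = back k (u 0) n + 1 * back k.+2 g n.
  exact: (back_lin k n gE).
have MB k : back k (u 3) n = back k (scl p g) n + p * back k.+2 (u 3) n.
  exact: (back_lin k n ME).
have uB i k : back k (u i) n = back k (u i.+1) n + r * q ^+ i * back k.+1 (u i.+1) n.
  exact: (back_lin k n (uE i)).
have sB k : back k (scl p g) n = back k (u 3) n - p * back k.+2 (u 3) n.
  by rewrite MB addrK.
rewrite -(back0 g) -(back0 (scl p g)) !sB.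
rewrite (gB 0%N) (gB 1%N) !(uB 0%N) !(uB 1%N) !(uB 2%N) /p /w /q; ring.
Qed.

(** This is w (r + r^5), produced by the Gaussian factor in [cap_fe]. It reappears on the
    Stieltjes-Wigert side through (r^2 + r^4)^2 = kappa + 2p. *)
Let kappa := r ^+ 4 + r ^+ 8.

(** Multiply [cap_gf_fe] by w^(n^2): by [gauss_back] each z^k acquires the constant w^(k^2) and the
    dilation by p^k. *)
Lemma cap_fe n : cap n = scl p cap n + p * back 1 (scl p cap) n
  + kappa * back 1 (scl (p ^+ 2) cap) n + p ^+ 2 * back 2 (scl (p ^+ 2) cap) n
  + p ^+ 3 * back 2 (scl (p ^+ 3) cap) n - p ^+ 5 * back 3 (scl (p ^+ 3) cap) n.
Proof.
have pw k : w ^+ (2 * k) = p ^+ k by rewrite /w /p -!exprM mulnA.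
have GB k : w ^+ (n ^ 2) * back k g n = w ^+ (k ^ 2) * back k (scl (p ^+ k) cap) n.
  by rewrite gauss_back pw.
have GBs k : w ^+ (n ^ 2) * back k (scl p g) n =
    w ^+ (k ^ 2) * back k (scl (p ^+ k.+1) cap) n.
  rewrite gauss_back pw; congr (_ * _); apply: eq_back => i.
  by rewrite /scl /cap -/g -/w exprSr [(p ^+ k * p) ^+ i]exprMn; ring.
have G0 : w ^+ (n ^ 2) * scl p g n = scl p cap n by rewrite /scl mulrCA.
rewrite {1}/cap -/g -/w cap_gf_fe.
transitivity (scl p cap n + w * (w ^+ (n ^ 2) * back 1 g n)
  + (r + r ^+ 5) * (w ^+ (n ^ 2) * back 1 (scl p g) n) + w ^+ (n ^ 2) * back 2 g n
  + p * (w ^+ (n ^ 2) * back 2 (scl p g) n) - w * (w ^+ (n ^ 2) * back 3 g n)).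
  by rewrite -G0; ring.
rewrite !GB !GBs expr1 /p /w /kappa; ring.
Qed.

(** Put H(z) = F(z)/(z; p)_oo and let [e j] be F(p^j z)/(z; p)_oo, so that H(p^j z) = (z; p)_j times
    [e j]. Multiplying [cap_fe] by (1 - z) (1 - pz) / (z; p)_oo then leaves only dilates of H: the
    last two terms carry the factor 1 - p^2 z that completes (z; p)_3. *)
Lemma cap_sum_fe n : cap_sum n - (1 + p) * back 1 cap_sum n + p * back 2 cap_sum n
  = scl p cap_sum n - p ^+ 2 * back 2 (scl p cap_sum) n
  + kappa * back 1 (scl p (scl p cap_sum)) n
  + p ^+ 2 * back 2 (scl p (scl p cap_sum)) n
  + p ^+ 3 * back 2 (scl p (scl p (scl p cap_sum))) n.
Proof.
have iotaE := fun i => qfac_fe i np.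
pose e j := conv (scl (p ^+ j) cap) (qfac p).
have eE j i : scl p (e j) i = e j.+1 i + (-1) * back 1 (e j.+1) i.
  rewrite scl_conv; have -> : conv (scl p (scl (p ^+ j) cap)) (scl p (qfac p)) i
      = conv (scl (p ^+ j.+1) cap) (scl p (qfac p)) i.
    by apply: eq_conv => // k; rewrite scl_scl -exprS.
  have E : e j.+1 i = conv (scl (p ^+ j.+1) cap) (scl p (qfac p)) i
      + 1 * back 1 (e j.+1) i by exact: conv_linr.
  by rewrite E; ring.
have e0 : cap_sum =1 e 0%N by move=> i; apply: eq_conv => // k; rewrite /scl expr1n mul1r.
have e1 i : scl p cap_sum i = e 1 i + (-1) * back 1 (e 1) i.
  by rewrite -eE /scl e0.
have e2 i : scl p (scl p cap_sum) i =
    (e 2 i + (-1) * back 1 (e 2) i) + (- p) * back 1 (scl p (e 1)) i.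
  by rewrite (scl_lin _ _ e1) -eE mulN1r.
have ps i : scl p (fun k => e 2 k + (-1) * back 1 (e 2) k) i =
    (e 3 i + (-1) * back 1 (e 3) i) + (- p) * back 1 (scl p (e 2)) i.
  by rewrite (@scl_lin _ (-1) p 1 _ (e 2) (e 2)) // -eE mulN1r.
have e3 i : scl p (scl p (scl p cap_sum)) i =
    ((e 3 i + (-1) * back 1 (e 3) i) + (- p) * back 1 (scl p (e 2)) i)
    + (- p ^+ 2) * back 1 (scl p (scl p (e 1))) i.
  by rewrite (scl_lin _ _ e2) ps; congr (_ + _ * _); rewrite mulNr.
have s1 k : back k (scl p (e 1)) n = back k (e 2) n + (-1) * back k.+1 (e 2) n.
  exact: (back_lin k n (eE 1%N)).
have s2 k : back k (scl p (e 2)) n = back k (e 3) n + (-1) * back k.+1 (e 3) n.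
  exact: (back_lin k n (eE 2%N)).
have s3 k : back k (scl p (scl p (e 1))) n = back k (scl p (e 2)) n
    + (- p) * back k.+1 (scl p (e 2)) n.
  have E i : scl p (scl p (e 1)) i = scl p (e 2) i + (- p) * back 1 (scl p (e 2)) i.
    by rewrite (scl_lin _ _ (eE 1%N)) mulN1r.
  exact: (back_lin k n E).
have b1 k : back k (scl p cap_sum) n = back k (e 1) n + (-1) * back k.+1 (e 1) n.
  exact: (back_lin k n e1).
have b2 k : back k (scl p (scl p cap_sum)) n =
    back k (e 2) n + (-1) * back k.+1 (e 2) n + (- p) * back k.+1 (scl p (e 1)) n.
  by rewrite (back_lin _ _ e2) (@back_lin _ k 1 _ (e 2) (e 2) (-1)).
have b3 k : back k (scl p (scl p (scl p cap_sum))) n =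
    back k (e 3) n + (-1) * back k.+1 (e 3) n + (- p) * back k.+1 (scl p (e 2)) n
    + (- p ^+ 2) * back k.+1 (scl p (scl p (e 1))) n.
  rewrite (back_lin _ _ e3); congr (_ + _).
  rewrite (@back_lin _ k 1 _ (fun i => e 3 i + (-1) * back 1 (e 3) i) (scl p (e 2)) (- p)) //.
  by rewrite (@back_lin _ k 1 _ (e 3) (e 3) (-1)).
have main i : e 0 i = e 1 i + p * back 1 (e 1) i + kappa * back 1 (e 2) i
    + p ^+ 2 * back 2 (e 2) i + p ^+ 3 * back 2 (e 3) i - p ^+ 5 * back 3 (e 3) i.
  rewrite -e0 /cap_sum -/p /e -!conv_back /conv !mulr_sumr -!big_split -sumrB /=.
  by apply: eq_bigr => k _; rewrite [in LHS]cap_fe expr1; ring.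
have mB k : back k cap_sum n = back k (e 1) n + p * back k.+1 (e 1) n
    + kappa * back k.+1 (e 2) n + p ^+ 2 * back k.+2 (e 2) n
    + p ^+ 3 * back k.+2 (e 3) n - p ^+ 5 * back k.+3 (e 3) n.
  have B1 a : back k.+1 a n = back k (back 1 a) n by rewrite back_back addn1.
  have B2 a : back k.+2 a n = back k (back 2 a) n by rewrite back_back addn2.
  have B3 a : back k.+3 a n = back k (back 3 a) n by rewrite back_back addn3.
  rewrite (eq_back _ _ e0) (eq_back _ _ main) !B1 !B2 !B3 /back.
  by case: ifP => // _; rewrite !mulr0 !addr0 subr0.
rewrite -(back0 cap_sum) -(back0 (scl p cap_sum)) !b3 !b2 !b1 !s3 !s2 !s1 !mB.
ring.
Qed.

Lemma cap_sum_rec n : (1 - p ^+ n.+2) * cap_sum n.+2 =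
  (1 + p + kappa * p ^+ (2 * n.+1)) * cap_sum n.+1
  - p * (1 + p ^+ n.+1) * (1 - p ^+ (2 * n).+1) * cap_sum n.
Proof.
have := cap_sum_fe n.+2; rewrite !(backD 1 _ n.+1) !(backD 2 _ n) /scl => E.
have -> : (1 - p ^+ n.+2) * cap_sum n.+2 =
   (cap_sum n.+2 - (1 + p) * cap_sum n.+1 + p * cap_sum n)
   + ((1 + p) * cap_sum n.+1 - p * cap_sum n - p ^+ n.+2 * cap_sum n.+2) by ring.
by rewrite E !mul2n -!addnn !(exprD, exprS); ring.
Qed.

Lemma cap_sum0 : cap_sum 0 = 1.
Proof.
rewrite /cap_sum /conv big_ord1 /cap /conv big_ord1 /cap_odd /cap_even /= !qfac0.
by rewrite !expr0 !mulr1.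
Qed.

Lemma cap_sum1 : (1 - p) * cap_sum 1 = 1 + p + kappa.
Proof.
have := cap_sum_fe 1; rewrite !(backD 1 _ 0) !(@back_lt _ 2) // /scl cap_sum0 => E.
have -> : (1 - p) * cap_sum 1 = cap_sum 1 - (1 + p) * 1 + p * 0 + (1 + p) - p * cap_sum 1.
  by ring.
by rewrite E; ring.
Qed.

(* [rs] has generating function (-r^4 z; p)_oo (-r^2 z; p)_oo. *)
Definition rs_pos k : K := r ^+ (3 * k ^ 2 + k) * qfac (r ^+ 6) k.

Definition rs_neg k : K := r ^+ (3 * k ^ 2 - k) * qfac (r ^+ 6) k.

Definition rs : nat -> K := conv rs_pos rs_neg.

Lemma rs_pos_fe k :
  rs_pos k = scl p rs_pos k + r ^+ 4 * back 1 (scl p rs_pos) k.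
Proof.
rewrite /rs_pos /scl -/p; case: k => [|k].
  by rewrite back_lt // mulr0 addr0 !expr0 !mul1r.
rewrite (backD 1 _ k) -(qfacS k np).
have -> : r ^+ (3 * k.+1 ^ 2 + k.+1) = r ^+ (3 * k ^ 2 + k) * p ^+ k * r ^+ 4.
  by rewrite /p -exprM -!exprD; congr (_ ^+ _); lia.
by ring.
Qed.

Lemma rs_neg_fe k :
  rs_neg k = scl p rs_neg k + r ^+ 2 * back 1 (scl p rs_neg) k.
Proof.
rewrite /rs_neg /scl -/p; case: k => [|k].
  by rewrite back_lt // mulr0 addr0 !expr0 !mul1r.
rewrite (backD 1 _ k) -(qfacS k np).
have -> : r ^+ (3 * k.+1 ^ 2 - k.+1) = r ^+ (3 * k ^ 2 - k) * p ^+ k * r ^+ 2.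
  by rewrite /p -exprM -!exprD; congr (_ ^+ _); nia.
by ring.
Qed.

Lemma rs_fe n : rs n = scl p rs n + (r ^+ 2 + r ^+ 4) * back 1 (scl p rs) n
  + p * back 2 (scl p rs) n.
Proof.
pose u := conv (scl p rs_pos) rs_neg.
have uE i : u i = scl p rs i + r ^+ 2 * back 1 (scl p rs) i.
  rewrite [LHS](conv_linr _ _ rs_neg_fe) scl_conv; congr (_ + _ * _).
  by apply: eq_back => k; rewrite scl_conv.
rewrite [LHS](conv_lin _ _ rs_pos_fe) -/u uE (back_lin _ _ uE) /p; ring.
Qed.

Let s n := qpoch p p n * rs n.

Lemma rs_rec n : s n.+2 = (r ^+ 2 + r ^+ 4) * p ^+ n.+1 * s n.+1
  + p ^+ n.+1 * (1 - p ^+ n.+1) * s n.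
Proof.
rewrite /s !qpochS.
have := rs_fe n.+2; rewrite !(backD 1 _ n.+1) !(backD 2 _ n) /scl => E.
have {}E : (1 - p * p ^+ n.+1) * rs n.+2 = (r ^+ 2 + r ^+ 4) * (p ^+ n.+1 * rs n.+1)
   + p * (p ^+ n * rs n) by rewrite mulrBl mul1r -exprS {1}E; ring.
by rewrite -mulrA E; rewrite !exprS; ring.
Qed.

Lemma rs0 : s 0 = 1.
Proof.
by rewrite /s qpoch0 mul1r /rs /conv big_ord1 /rs_pos /rs_neg /= !qfac0 !expr0 !mulr1.
Qed.

Lemma rs1 : s 1 = r ^+ 2 + r ^+ 4.
Proof.
have := rs_fe 1; rewrite !(backD 1 _ 0) !(@back_lt _ 2) // /scl => E.
have r0 := rs0; rewrite /s qpoch0 mul1r in r0.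
rewrite /s qpochS qpoch0 expr0 mulr1 mul1r mulrBl mul1r {1}E r0; ring.
Qed.

(** Applying [rs_rec] at three consecutive indices eliminates the odd-indexed terms. *)
Lemma rs_rec2 n : s (2 * n.+2) =
  p ^+ (2 * n + 3) * (1 + p + kappa * p ^+ (2 * n.+1)) * s (2 * n.+1)
  - p ^+ (4 * n + 5) * (1 - p ^+ (2 * n).+2) * (1 - p ^+ (2 * n).+1) * s (2 * n).
Proof.
have -> : (2 * n.+2 = (2 * n).+4)%N by lia.
have -> : (2 * n.+1 = (2 * n).+2)%N by lia.
have -> : (4 * n + 5 = 2 * n + 2 * n + 5)%N by lia.
move: (2 * n)%N => m.
rewrite (rs_rec m.+2) (rs_rec m.+1).
have E : (r ^+ 2 + r ^+ 4) * p ^+ m.+1 * s m.+1 = s m.+2 - p ^+ m.+1 * (1 - p ^+ m.+1) * s m.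
  by rewrite [s m.+2]rs_rec; ring.
transitivity ((r ^+ 2 + r ^+ 4) * p ^+ m.+3 * ((r ^+ 2 + r ^+ 4) * p ^+ m.+2 * s m.+2)
  + p ^+ m.+3 * p ^+ 1 * (1 - p ^+ m.+2) * ((r ^+ 2 + r ^+ 4) * p ^+ m.+1 * s m.+1)
  + p ^+ m.+3 * (1 - p ^+ m.+3) * s m.+2).
  by rewrite !exprS; ring.
by rewrite E !exprD !exprS /kappa /p; ring.
Qed.

(** Once normalised, both sides satisfy the same three-term recurrence ([cap_sum_rec], [rs_rec2])
    and agree at n = 0 and n = 1; the induction carries two consecutive indices. *)
Theorem cap_sum_rs n :
  p ^+ (n ^ 2) * (qpoch p p n * cap_sum n) = qpoch p p (2 * n) * rs (2 * n).
Proof.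
rewrite -/(s (2 * n)).
suff [] : p ^+ (n ^ 2) * (qpoch p p n * cap_sum n) = s (2 * n) /\
   p ^+ (n.+1 ^ 2) * (qpoch p p n.+1 * cap_sum n.+1) = s (2 * n.+1) by [].
elim: n => [|n [IH0 IH1]].
  split; first by rewrite muln0 rs0 qpoch0 cap_sum0 !expr0 !mulr1.
  rewrite (rs_rec 0) rs1 rs0 qpochS qpoch0 expr0 mul1r mulr1 cap_sum1 /kappa /p; ring.
split=> //.
rewrite rs_rec2 -IH0 -IH1 2!qpochS -!exprS.
have -> : qpoch p p n * (1 - p ^+ n.+1) * (1 - p ^+ n.+2) * cap_sum n.+2 =
   qpoch p p n * (1 - p ^+ n.+1) * ((1 - p ^+ n.+2) * cap_sum n.+2) by ring.
rewrite cap_sum_rec.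
have -> : (n.+2 ^ 2 = n ^ 2 + 4 * n + 4)%N by lia.
have -> : (n.+1 ^ 2 = n ^ 2 + 2 * n + 1)%N by lia.
have -> : (2 * n.+1 = (2 * n).+2)%N by lia.
have -> : p ^+ (2 * n).+2 = (p ^+ n.+1) ^+ 2 by rewrite -exprM; congr (_ ^+ _); lia.
rewrite !(exprD, exprS).
ring.
Qed.

End Capparelli.

(** * Rearrangement of finite sums *)

Section BigSums.
Variable V : nmodType.

Lemma sum_center (F : nat -> V) k :
  \sum_(i < (2 * k).+1) F i =
  F k + \sum_(j < k) (F (k + j.+1)%N + F (k - j.+1)%N).
Proof.
rewrite -(big_mkord xpredT F) (big_cat_nat (n := k)) ?leqW ?leq_pmull //=.
rewrite [X in _ + X]big_ltn; last by rewrite ltnS leq_pmull.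
rewrite addrCA big_split /=; congr (_ + _); rewrite addrC; congr (_ + _).
  rewrite -{1}[k.+1]add0n big_addn big_mkord.
  have -> : ((2 * k).+1 - k.+1 = k)%N by lia.
  by apply: eq_bigr => i _; rewrite addnC addSnnS.
rewrite big_mkord (reindex_inj rev_ord_inj) /=.
by apply: eq_bigr => i _.
Qed.

Lemma sum_triangle (F : nat -> nat -> V) k :
  \sum_(i < k.+1) \sum_(j < i.+1) F i j =
  \sum_(j < k.+1) \sum_(i < (k - j).+1) F (j + i)%N j.
Proof.
elim: k => [|k IHk]; first by rewrite !big_ord1.
rewrite big_ord_recr /= IHk [in RHS]big_ord_recr /= subnn big_ord1 addn0.
rewrite [X in _ + X]big_ord_recr /= addrA; congr (_ + _).
rewrite -big_split /=; apply: eq_bigr => j _.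
by rewrite subSn ?leq_ord // [in RHS]big_ord_recr /= -subSn ?leq_ord // subnKC // ltnW // ltnS ltnW.
Qed.

End BigSums.

(** * Bailey's lemma and the finite Jacobi triple product *)

Section Bailey.
Variable K : fieldType.
Implicit Types (p q : K) (alpha beta : nat -> K).

(* [bailey p alpha] is the sequence beta forming with alpha a Bailey pair
   relative to a = 1 in base p. *)
Definition bailey p alpha k : K :=
  \sum_(r < k.+1) alpha r * qfac p (k - r) * qfac p (k + r).

(** The beta side of Bailey's lemma with both free parameters sent to infinity. *)
Definition bailey_next p beta k : K :=
  \sum_(M < k.+1) p ^+ (M ^ 2) * qfac p (k - M) * beta M.

Lemma eq_bailey p alpha alpha' k : alpha =1 alpha' ->
  bailey p alpha k = bailey p alpha' k.
Proof. by move=> E; apply: eq_bigr => i _; rewrite E. Qed.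

(** After exchanging the sums, the inner sum over M = r + i is [durfee_sum] with m = 2r and n = k -
    r. *)
Lemma bailey_nextE p alpha k : nonunity p ->
  bailey_next p (bailey p alpha) k = bailey p (fun r => p ^+ (r ^ 2) * alpha r) k.
Proof.
move=> np; rewrite /bailey_next /bailey.
under eq_bigr do rewrite mulr_sumr.
rewrite (sum_triangle (fun M r => p ^+ (M ^ 2) * qfac p (k - M) *
  (alpha r * qfac p (M - r) * qfac p (M + r)))).
apply: eq_bigr => r _.
have := durfee_sum (2 * r) (k - r) np; rewrite /conv => E.
have -> : (k + r = k - r + 2 * r)%N by move: (leq_ord r); lia.
rewrite -!mulrA -E !mulr_sumr; apply: eq_bigr => i _.
have -> : ((r + i) ^ 2 = r ^ 2 + (i ^ 2 + 2 * r * i))%N by lia.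
have -> : (k - (r + i) = k - r - i)%N by lia.
have -> : (r + i - r = i)%N by lia.
have -> : (r + i + r = i + 2 * r)%N by lia.
by rewrite exprD; ring.
Qed.

Lemma bailey_iter p alpha j k : nonunity p ->
  iter j (bailey_next p) (bailey p alpha) k =
  bailey p (fun r => p ^+ (j * r ^ 2) * alpha r) k.
Proof.
move=> np; elim: j k => [|j IHj] k.
  by apply: eq_bailey => r; rewrite mul0n mul1r.
rewrite iterS -(@eq_bailey _ (fun r => p ^+ (r ^ 2) * (p ^+ (j * r ^ 2) * alpha r))).
  by rewrite -bailey_nextE //; apply: eq_bigr => i _; rewrite IHj.
by move=> r; rewrite mulrA -exprD mulSn.
Qed.

(** The terms r and -r of the bilateral series of q^(a r^2 + r), folded together; r = 0 is counted
    once. *)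
Definition theta_term q a r : K :=
  if r is 0%N then 1 else q ^+ (a * r ^ 2 + r) + q ^+ (a * r ^ 2 - r).

Lemma theta_termM q a b r :
  (0 < a)%N -> (q ^+ b) ^+ (r ^ 2) * theta_term q a r = theta_term q (b + a) r.
Proof.
case: r => [|r] a0 /=; first by rewrite mulr1 expr0.
rewrite mulrDr -exprM -!exprD; congr (q ^+ _ + q ^+ _); first by lia.
by rewrite addnBA; [congr (_ - _)%N; lia | nia].
Qed.

(** Common last step of [finite_jacobi] and [cap_bailey]: after recentring at k, x holds the power
    of q that is independent of j. *)
Lemma sum_center_bailey p q a (x : K) (F : nat -> K) k :
  (forall j, (j <= k)%N -> F (k + j)%N =
     x * (q ^+ (a * j ^ 2 + j) * qfac p (k - j) * qfac p (k + j))) ->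
  (forall j, (j <= k)%N -> F (k - j)%N =
     x * (q ^+ (a * j ^ 2 - j) * qfac p (k - j) * qfac p (k + j))) ->
  \sum_(i < (2 * k).+1) F i = x * bailey p (theta_term q a) k.
Proof.
move=> Fp Fm; rewrite sum_center /bailey big_ord_recl mulrDr /=; congr (_ + _).
  by have := Fp 0%N isT; rewrite addn0 muln0 expr0 subn0 => ->.
rewrite mulr_sumr; apply: eq_bigr => j _; rewrite Fp // Fm //= /bump /=; ring.
Qed.

Lemma bin2D i : (2 * 'C(i, 2) + i = i ^ 2)%N.
Proof. by elim: i => // i IHi; rewrite binS bin1; lia. Qed.

(** For j >= k factor out q^(2ak); for j < k factor out q^(a+1+2aj) instead, which leaves 1 +
    q^(a-1) q^(2a(k-1-j)). *)
Lemma jacobi_prod q a k : (0 < a)%N ->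
  \prod_(j < 2 * k) (q ^+ (2 * a * k) + q ^+ a.+1 * q ^+ (2 * a) ^+ j) =
  q ^+ (3 * a * k ^ 2 + k) * (qpoch (- q ^+ a.+1) (q ^+ (2 * a)) k *
    qpoch (- q ^+ a.-1) (q ^+ (2 * a)) k).
Proof.
move=> a0; rewrite mul2n -addnn big_split_ord /=.
have -> : \prod_(j < k) (q ^+ (2 * a * k) + q ^+ a.+1 * q ^+ (2 * a) ^+ (k + j)) =
    q ^+ (2 * a * k ^ 2) * qpoch (- q ^+ a.+1) (q ^+ (2 * a)) k.
  have -> : q ^+ (2 * a * k ^ 2) = \prod_(j < k) q ^+ (2 * a * k).
    by rewrite prodr_const card_ord -exprM; congr (_ ^+ _); lia.
  rewrite -big_split /=.
  by apply: eq_bigr => j _; rewrite exprD -(exprM q); ring.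
have -> : \prod_(j < k) (q ^+ (2 * a * k) + q ^+ a.+1 * q ^+ (2 * a) ^+ j) =
    q ^+ (a * k ^ 2 + k) * qpoch (- q ^+ a.-1) (q ^+ (2 * a)) k.
  have -> : q ^+ (a * k ^ 2 + k) = \prod_(j < k) q ^+ (a.+1 + 2 * a * j).
    elim: k => [|k IHk]; first by rewrite muln0 big_ord0.
    by rewrite big_ord_recr /= -IHk -exprD; congr (_ ^+ _); lia.
  rewrite [X in X * _](reindex_inj rev_ord_inj) [LHS](reindex_inj rev_ord_inj) /=.
  rewrite -big_split /=; apply: eq_bigr => j _.
  rewrite mulNr opprK mulrDr mulr1 addrC -!exprM -!exprD.
  congr (_ + _ ^+ _); have [i E] : exists i, k = (i + j).+1.
    by exists (k - j.+1)%N; have := ltn_ord j; lia.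
  have -> : (k - j.+1 = i)%N by lia.
  by case: a a0 => // b _; move: (j : nat) E => l -> /=; lia.
by rewrite mulrACA [q ^+ _ * q ^+ _]mulrC -exprD [qpoch _ _ _ * _]mulrC; congr (_ ^+ _ * _); lia.
Qed.

(** [q_binomial] at index 2k in base P = q^(2a), with x = q^(a+1) and y = q^(2ak) chosen so that the
    expansion is centred at k. *)
Lemma finite_jacobi q a k : q != 0 -> nonunity q -> (0 < a)%N ->
  bailey (q ^+ (2 * a)) (theta_term q a) k =
  qpoch (- q ^+ a.+1) (q ^+ (2 * a)) k * qpoch (- q ^+ a.-1) (q ^+ (2 * a)) k
  * qfac (q ^+ (2 * a)) (2 * k).
Proof.
move=> q0 nq a0; set P := q ^+ (2 * a).
have nP : nonunity P by apply: nonunityX => //; rewrite muln_gt0.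
have qe : q ^+ (3 * a * k ^ 2 + k) != 0 by rewrite expf_neq0.
apply: (mulfI qe).
have := q_binomial (q ^+ a.+1) (q ^+ (2 * a * k)) (2 * k) nP.
rewrite jacobi_prod // -/P -[in RHS]mulrA => <-.
have P2 i : q ^+ a.+1 ^+ i * P ^+ 'C(i, 2) = q ^+ (a * i ^ 2 + i).
  by rewrite /P -!exprM -exprD -bin2D; congr (q ^+ _); lia.
apply/esym/(sum_center_bailey (F := fun i => q ^+ a.+1 ^+ i * P ^+ 'C(i, 2) * qfac P i *
   (q ^+ (2 * a * k) ^+ (2 * k - i) * qfac P (2 * k - i)))) => j le_jk.
  have -> : (2 * k - (k + j) = k - j)%N by lia.
  have -> : q ^+ a.+1 ^+ (k + j) * P ^+ 'C(k + j, 2) * qfac P (k + j) *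
      (q ^+ (2 * a * k) ^+ (k - j) * qfac P (k - j)) =
      (q ^+ a.+1 ^+ (k + j) * P ^+ 'C(k + j, 2)) * q ^+ (2 * a * k) ^+ (k - j) *
      (qfac P (k - j) * qfac P (k + j)) by ring.
  rewrite P2 -(exprM q) -exprD -[in RHS]mulrA [in RHS]mulrA -[in RHS]exprD.
  congr (q ^+ _ * _); have [i ->] : exists i, k = (i + j)%N by exists (k - j)%N; lia.
  by rewrite addnK; lia.
have -> : (2 * k - (k - j) = k + j)%N by lia.
have -> : q ^+ a.+1 ^+ (k - j) * P ^+ 'C(k - j, 2) * qfac P (k - j) *
    (q ^+ (2 * a * k) ^+ (k + j) * qfac P (k + j)) =
    (q ^+ a.+1 ^+ (k - j) * P ^+ 'C(k - j, 2)) * q ^+ (2 * a * k) ^+ (k + j) *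
    (qfac P (k - j) * qfac P (k + j)) by ring.
rewrite P2 -(exprM q) -exprD -[in RHS]mulrA [in RHS]mulrA -[in RHS]exprD.
congr (q ^+ _ * _); have [i ->] : exists i, k = (i + j)%N by exists (k - j)%N; lia.
rewrite addnK addnBA; first by apply/eqP; rewrite -(eqn_add2r j) subnK; [apply/eqP; lia|nia].
nia.
Qed.

(** In [rs (2 * N)] the exponents at N + j and N - j add up to 6N^2 + 6j^2 + 2j. The part r^(6N^2)
    cancels p^(N^2) in [cap_sum_rs], and q^(3j^2 + j) is a theta term; -j is similar. *)
Lemma cap_bailey (r : K) N : r != 0 -> nonunity r ->
  qpoch (r ^+ 6) (r ^+ 6) N * qfac (r ^+ 6) (2 * N) * cap_sum r N =
  bailey (r ^+ 6) (theta_term (r ^+ 2) 3) N.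
Proof.
move=> r0 nr; have np : nonunity (r ^+ 6) by exact: nonunityX.
have pN : (r ^+ 6) ^+ (N ^ 2) != 0 by rewrite !expf_neq0.
apply: (mulfI pN); rewrite mulrAC [_ * (_ * _ * _)]mulrA cap_sum_rs //.
rewrite mulrAC /qfac divff ?mul1r ?qpoch_neq0 //.
apply: (sum_center_bailey (F := fun i => rs_pos r i * rs_neg r (2 * N - i))) => j le_jN.
  have -> : (2 * N - (N + j) = N - j)%N by lia.
  transitivity (r ^+ (3 * (N + j) ^ 2 + (N + j)) * r ^+ (3 * (N - j) ^ 2 - (N - j)) *
    (qfac (r ^+ 6) (N - j) * qfac (r ^+ 6) (N + j))); first by rewrite /rs_pos /rs_neg; ring.
  rewrite -[in RHS]mulrA [in RHS]mulrA -!exprM -!exprD.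
  congr (r ^+ _ * _); have [i ->] : exists i, N = (i + j)%N by exists (N - j)%N; lia.
  by rewrite addnK addnBA; [apply/eqP; rewrite -(eqn_add2r i) subnK; [apply/eqP; lia|nia]|nia].
have -> : (2 * N - (N - j) = N + j)%N by lia.
transitivity (r ^+ (3 * (N - j) ^ 2 + (N - j)) * r ^+ (3 * (N + j) ^ 2 - (N + j)) *
  (qfac (r ^+ 6) (N - j) * qfac (r ^+ 6) (N + j))); first by rewrite /rs_pos /rs_neg; ring.
rewrite -[in RHS]mulrA [in RHS]mulrA -!exprM -!exprD.
congr (r ^+ _ * _); have [i ->] : exists i, N = (i + j)%N by exists (N - j)%N; lia.
rewrite addnK !mulnBr.
rewrite !addnBA; [|nia|nia]; apply/eqP; rewrite -(eqn_add2r (i + j + j)) subnK; last by nia.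
apply/eqP; nia.
Qed.

End Bailey.

(** * The multiple sum *)

Section Multisum.

Lemma sum_ord_extend (V : nmodType) (F : nat -> V) m n : (m <= n)%N ->
  (forall i, (m <= i)%N -> F i = 0) -> \sum_(i < m) F i = \sum_(i < n) F i.
Proof.
move=> le_mn F0; rewrite (big_ord_widen _ F le_mn) [in RHS](bigID (fun i : 'I_n => i < m)%N) /=.
by rewrite [X in _ = _ + X]big1 ?addr0 // => i; rewrite -leqNgt => /F0.
Qed.

Lemma sum_even (V : nmodType) (F : nat -> V) n :
  (forall i, odd i -> F i = 0) -> \sum_(i < 2 * n) F i = \sum_(i < n) F (2 * i)%N.
Proof.
move=> F0; elim: n => [|n IHn]; first by rewrite !big_ord0.
rewrite mulnS !add2n !big_ord_recr /= IHn [F (2 * n).+1]F0 ?addr0 //.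
by rewrite /= oddM.
Qed.

Lemma qpochV_sub (K : fieldType) (a p : K) N n m :
  qpochV a p (N%:Z - 2 * n%:Z - m%:Z) =
  if (m + 2 * n <= N)%N then (qpoch a p (N - (m + 2 * n)))^-1 else 0.
Proof.
case: ifP => [le_N|/negbT lt_N].
  by have -> : N%:Z - 2 * n%:Z - m%:Z = (N - (m + 2 * n))%N by lia.
have [k ->] : exists k, N%:Z - 2 * n%:Z - m%:Z = Negz k.
  by exists (m + 2 * n - N).-1; lia.
by [].
Qed.

Definition cap_term (K : fieldType) (q : K) N m n : K :=
  q ^+ (2 * m ^ 2 + 6 * m * n + 6 * n ^ 2)%N
  * qpochV (q ^+ 3) (q ^+ 3) (N%:Z - 2 * n%:Z - m%:Z)
  / (qpoch q q m * qpoch (q ^+ 3) (q ^+ 3) n).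

(** The convention for 1/(p; p)_z kills all terms with m + 2n > N, so any square with k >= N
    captures the whole sum. *)
Lemma cap_double_sum (K : fieldType) (r : K) N k : (N <= k)%N ->
  \sum_(m < k.+1) \sum_(n < k.+1) cap_term (r ^+ 2) N m n = cap_sum r N.
Proof.
move=> le_Nk; rewrite /cap_sum /conv.
pose H i j := (r ^+ 3) ^+ ((i + j) ^ 2) * (cap_odd r i * cap_even r j)
              * qfac (r ^+ 6) (N - (i + j)).
pose G i j := if (i + j <= N)%N then H i j else 0.
transitivity (\sum_(s < N.+1) \sum_(i < s.+1) H i (s - i)%N); last first.
  apply: eq_bigr => s _; rewrite /cap /conv mulr_sumr mulr_suml.
  by apply: eq_bigr => i _; rewrite /H subnKC // leq_ord.
rewrite (sum_triangle (fun s i => H i (s - i)%N)).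
(* Here j stands for 2n: the range below 2(k+1) has as even members exactly the 2n with n <= k. *)
transitivity (\sum_(i < N.+1) \sum_(j < 2 * k.+1) G i j); last first.
  apply: eq_bigr => i _.
  have le_i : (i <= N)%N by rewrite leq_ord.
  rewrite -(@sum_ord_extend _ (G i) (N - i).+1).
  - apply: eq_bigr => j _; rewrite addKn /G; case: ifP => //.
    by have := leq_ord j; lia.
  - by lia.
  - by move=> j lt_j; rewrite /G; case: ifP => //; lia.
rewrite (@sum_ord_extend _ (fun i => \sum_(j < 2 * k.+1) G i j) N.+1 k.+1) //; last first.
  by move=> i lt_i; apply: big1 => j _; rewrite /G; case: ifP => //; lia.
apply: eq_bigr => m _; rewrite sum_even; last first.
  by move=> i oi; rewrite /G; case: ifP => // _; rewrite /H /cap_even oi !mulr0 mul0r.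
apply: eq_bigr => n _; rewrite /cap_term qpochV_sub /G.
case: ifP => _; last by rewrite mulr0 mul0r.
have -> : (r ^+ 2) ^+ 3 = r ^+ 6 by rewrite -exprM.
rewrite /H /cap_odd /cap_even [(2 * n)%N]mul2n odd_double doubleK invfM /qfac -!exprM.
have -> : r ^+ (2 * (2 * m ^ 2 + 6 * m * n + 6 * n ^ 2)) =
  r ^+ (3 * (m + n.*2) ^ 2) * r ^+ (m ^ 2) by rewrite -exprD; congr (_ ^+ _); lia.
ring.
Qed.

Fixpoint compositions (f M : nat) : seq (f.-tuple nat) :=
  match f with
  | 0%N => if M == 0%N then [:: [tuple]] else [::]
  | f'.+1 => [seq cons_tuple n t | n <- iota 0 M.+1, t <- compositions f' (M - n)%N]
  end.

Lemma mem_compositions f M (t : f.-tuple nat) :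
  (t \in compositions f M) = (sumn t == M).
Proof.
elim: f M t => [|f IHf] M t.
  by rewrite tuple0; case: M => [|M]; rewrite ?inE ?eqxx.
apply/idP/eqP => [/allpairsPdep[n [u [ln lu ->]]]|].
  move: ln lu; rewrite mem_iota IHf /= => ln /eqP ->; lia.
case/tupleP: t => n t E; rewrite /= in E; apply/allpairsPdep; exists n, t; split => //.
  by rewrite mem_iota; lia.
by rewrite IHf -E addKn.
Qed.

Lemma compositions_uniq f M : uniq (compositions f M).
Proof.
elim: f M => [|f IHf] M; first by rewrite /=; case: ifP.
apply: allpairs_uniq_dep => [|n _|]; [exact: iota_uniq|exact: IHf|].
move=> [n t] [n' t'] _ _ /= /(congr1 val) /= [-> E].
by congr existT; apply: val_inj.
Qed.

Variable K : fieldType.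
Implicit Types (p q : K) (beta : nat -> K).

(** For s = (n_1, ..., n_f) this is p^(N_1^2 + ... + N_f^2) beta(n_f) / ((p; p)_(n_1) ... (p;
    p)_(n_(f-1))). The value 0 on the empty list keeps it linear in [beta]. *)
Fixpoint chain_term p beta (s : seq nat) : K :=
  match s with
  | [::] => 0
  | [:: n] => p ^+ (n ^ 2) * beta n
  | n :: s' => p ^+ (sumn s ^ 2) * qfac p n * chain_term p beta s'
  end.

Lemma chain_term_cons p beta n s : (0 < size s)%N ->
  chain_term p beta (n :: s) = p ^+ ((n + sumn s) ^ 2) * qfac p n * chain_term p beta s.
Proof. by case: s. Qed.

Lemma sum_compositionsS f M (F : f.+1.-tuple nat -> K) :
  \sum_(t <- compositions f.+1 M) F t =
  \sum_(n < M.+1) \sum_(t <- compositions f (M - n)) F (cons_tuple (n : nat) t).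
Proof.
have -> : compositions f.+1 M =
  [seq cons_tuple n t | n <- index_iota 0 M.+1, t <- compositions f (M - n)%N].
  by rewrite /index_iota subn0.
by rewrite big_allpairs_dep big_mkord.
Qed.

(** With N_1 = M fixed, the sum over N_2 = i and n_1 = M - i is one Bailey step; induct on the
    remaining entries. *)
Lemma sum_chain_term p beta f M :
  \sum_(t <- compositions f.+1 M) chain_term p beta t =
  p ^+ (M ^ 2) * iter f (bailey_next p) beta M.
Proof.
elim: f M => [|f IHf] M.
  rewrite sum_compositionsS (bigD1 ord_max) //= subnn [X in X + _]big_seq1 /=.
  rewrite big1 ?addr0 // => n nM; rewrite ifN ?big_nil //.
  by have := leq_ord n; move: nM; rewrite -val_eqE /=; lia.
rewrite sum_compositionsS iterS {1}/bailey_next mulr_sumr (reindex_inj rev_ord_inj).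
apply: eq_bigr => i _; rewrite [rev_ord i : nat]/=.
have le_iM := leq_ord i.
have -> : (M - (M.+1 - i.+1) = i)%N by lia.
rewrite subSS.
transitivity (\sum_(t <- compositions f.+1 i)
   p ^+ (M ^ 2) * qfac p (M - i) * chain_term p beta t); last first.
  by rewrite -mulr_sumr IHf; ring.
apply: eq_big_seq => t; rewrite mem_compositions => /eqP st.
by rewrite chain_term_cons ?size_tuple // st subnK.
Qed.

Lemma entry_cons f (t : f.-tuple nat) n i :
  (0 < i)%N -> entry (cons_tuple n t) i.+1 = entry t i.
Proof. by case: i. Qed.

Lemma tail_sum_cons f (t : f.-tuple nat) n i :
  (0 < i)%N -> tail_sum (cons_tuple n t) i.+1 = tail_sum t i.
Proof.
move=> i0; rewrite /tail_sum big_add1 /=; apply: eq_big_nat => j /andP[lij _].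
by rewrite entry_cons // (leq_trans i0).
Qed.

Lemma tail_sum1 f (t : f.-tuple nat) : tail_sum t 1 = sumn t.
Proof.
by rewrite /tail_sum big_add1 /= sumnE [RHS](big_nth 0%N) size_tuple.
Qed.

Lemma chain_term_tuple p beta f (t : f.+1.-tuple nat) :
  chain_term p beta t =
  p ^+ (\sum_(1 <= i < f.+2) tail_sum t i ^ 2)
  * (\prod_(1 <= i < f.+1) qpoch p p (entry t i))^-1 * beta (entry t f.+1).
Proof.
elim: f t => [|f IHf] t; case/tupleP: t => n t.
  rewrite big_nat1 big_geq // invr1 mulr1 tail_sum1 tuple0 /= addn0.
  by rewrite /entry /=.
have sz : (0 < size t)%N by rewrite size_tuple.
rewrite [LHS](chain_term_cons p beta n sz) IHf.
have -> : (\sum_(1 <= i < f.+3) tail_sum [tuple of n :: t] i ^ 2 =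
  (n + sumn t) ^ 2 + \sum_(1 <= i < f.+2) tail_sum t i ^ 2)%N.
  rewrite big_ltn // tail_sum1 /= big_add1 /=; congr (_ + _)%N.
  by apply: eq_big_nat => i /andP[i0 _]; rewrite tail_sum_cons.
have -> : \prod_(1 <= i < f.+2) qpoch p p (entry [tuple of n :: t] i) =
  qpoch p p n * \prod_(1 <= i < f.+1) qpoch p p (entry t i).
  rewrite big_ltn // big_add1 /=; congr (_ * _).
  by apply: eq_big_nat => i /andP[i0 _]; rewrite entry_cons.
by rewrite entry_cons // exprD invfM /qfac; ring.
Qed.

Lemma summandE q f (t : f.+1.-tuple nat) m n :
  summand t q m n = chain_term (q ^+ 3) (fun N =>
    qpoch (q ^+ 3) (q ^+ 3) N * qfac (q ^+ 3) (2 * N) * cap_term q N m n) t.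
Proof.
rewrite chain_term_tuple /summand /cap_term /qfac exprD (exprM q 3) !invfM; ring.
Qed.

Lemma chain_term_sum p (I : Type) (s : seq I) (b : I -> nat -> K) t :
  \sum_(i <- s) chain_term p (b i) t = chain_term p (fun N => \sum_(i <- s) b i N) t.
Proof.
elim: t => [|n t IHt]; first by rewrite big1.
by case: t IHt => [|n' t] IHt; rewrite -mulr_sumr // IHt.
Qed.

Lemma eq_chain_term p beta beta' t : {in t, beta =1 beta'} ->
  chain_term p beta t = chain_term p beta' t.
Proof.
elim: t => [//|n t IHt] E.
case: t IHt E => [|n' t] IHt E /=; first by rewrite E ?mem_head.
by congr (_ * _); apply: IHt => i it; rewrite E // in_cons it orbT.
Qed.

Fixpoint bounded_tuples f k : seq (f.-tuple nat) :=
  compositions f k ++ (if k is k'.+1 then bounded_tuples f k' else [::]).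

Lemma mem_bounded_tuples f k (t : f.-tuple nat) :
  (t \in bounded_tuples f k) = (sumn t <= k)%N.
Proof.
elim: k => [|k IHk]; first by rewrite [bounded_tuples _ _]cats0 mem_compositions leqn0.
by rewrite mem_cat mem_compositions IHk [RHS]leq_eqVlt ltnS.
Qed.

Lemma bounded_tuples_uniq f k : uniq (bounded_tuples f k).
Proof.
elim: k => [|k IHk]; first by rewrite [bounded_tuples _ _]cats0 compositions_uniq.
rewrite cat_uniq compositions_uniq IHk andbT /=; apply/hasPn => t.
by rewrite mem_bounded_tuples /= mem_compositions => lt; rewrite neq_ltn ltnS lt.
Qed.

Lemma sum_bounded_tuples f k (F : f.-tuple nat -> K) :
  \sum_(t <- bounded_tuples f k) F t = \sum_(M < k.+1) \sum_(t <- compositions f M) F t.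
Proof.
elim: k => [|k IHk]; first by rewrite [bounded_tuples _ _]cats0 big_ord1.
by rewrite big_cat [in RHS]big_ord_recr /= IHk addrC.
Qed.

(** Finite sets exhausting the indices. Bounding N_1 rather than each entry makes the partial sum a
    sum over M = N_1 of iterated Bailey steps. *)
Definition box f k : seq (nat * nat * f.-tuple nat) :=
  [seq (mn, t) | mn <- [seq (m, n) | m <- iota 0 k.+1, n <- iota 0 k.+1],
                 t <- bounded_tuples f k].

Lemma mem_box f k m n (t : f.-tuple nat) :
  ((m, n, t) \in box f k) = [&& (m <= k)%N, (n <= k)%N & (sumn t <= k)%N].
Proof.
apply/allpairsP/and3P => [[[[m' n'] u] [+ + E]]|[lm ln lt]].
  case: E => -> -> ->; rewrite mem_bounded_tuples.
  by case/allpairsP => -[a b] [+ + [-> ->]]; rewrite !mem_iota.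
exists ((m, n), t); split => //; last by rewrite mem_bounded_tuples.
by apply/allpairsP; exists (m, n); rewrite !mem_iota.
Qed.

Lemma box_uniq f k : uniq (box f k).
Proof.
apply: allpairs_uniq; last by move=> [[? ?] ?] [[? ?] ?] _ _ [-> -> ->].
  by apply: allpairs_uniq; rewrite ?iota_uniq // => -[? ?] [? ?] _ _ [-> ->].
exact: bounded_tuples_uniq.
Qed.

Lemma box_sub f k l : (k <= l)%N -> {subset box f k <= box f l}.
Proof.
by move=> lkl [[m n] t]; rewrite !mem_box => /and3P[? ? ?]; rewrite !(leq_trans _ lkl).
Qed.

(** Exact at every k: n_f <= N_1 = M <= k, so truncating m and n at k loses nothing. *)
Lemma sum_box (r : K) f k :
  \sum_(x <- box f.+1 k) (let: (m, n, ns) := x in summand ns (r ^+ 2) m n) =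
  \sum_(M < k.+1) (r ^+ 6) ^+ (M ^ 2) * iter f (bailey_next (r ^+ 6)) (fun N =>
    qpoch (r ^+ 6) (r ^+ 6) N * qfac (r ^+ 6) (2 * N) * cap_sum r N) M.
Proof.
rewrite big_allpairs exchange_big sum_bounded_tuples.
apply: eq_bigr => M _; rewrite -sum_chain_term; apply: eq_big_seq => t.
rewrite mem_compositions => /eqP st.
rewrite (eq_bigr (fun mn => chain_term ((r ^+ 2) ^+ 3) (fun N =>
  qpoch (r ^+ 2 ^+ 3) (r ^+ 2 ^+ 3) N * qfac (r ^+ 2 ^+ 3) (2 * N) *
  cap_term (r ^+ 2) N mn.1 mn.2) t)); last by move=> [m n] _; rewrite summandE.
rewrite chain_term_sum -[(r ^+ 2) ^+ 3]exprM; apply: eq_chain_term => N Nt.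
rewrite -mulr_sumr big_allpairs -[k.+1]subn0 -/(index_iota 0 k.+1) big_mkord.
under eq_bigr do rewrite big_mkord.
rewrite cap_double_sum //; apply: leq_trans (leq_ord M); rewrite -st.
by rewrite sumnE (big_rem N) //= leq_addr.
Qed.

End Multisum.

(** * Infinite products and limits *)

Section Bounds.
Variable K : numFieldType.
Implicit Types (a p q x : K).

Lemma sum_geo_le x n : 0 <= x -> x < 1 -> \sum_(i < n) x ^+ i <= (1 - x)^-1.
Proof.
move=> x0 x1; have x10 : 0 < 1 - x by rewrite subr_gt0.
rewrite -[leRHS]mul1r ler_pdivlMr // mulrC -opprB mulNr -subrX1 opprB.
by rewrite gerBl exprn_ge0.
Qed.

Lemma prod_1B_ge (x : nat -> K) n : (forall i, 0 <= x i <= 1) ->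
  1 - \sum_(i < n) x i <= \prod_(i < n) (1 - x i).
Proof.
move=> x01.
have P01 m : 0 <= \prod_(i < m) (1 - x i) <= 1.
  apply: (big_ind (fun y => 0 <= y <= 1)) => [|y z /andP[y0 y1] /andP[z0 z1]|i _].
  - by rewrite ler01 lexx.
  - by rewrite mulr_ge0 // mulr_ile1.
  - by have /andP[? ?] := x01 i; rewrite subr_ge0 gerBl; apply/andP.
elim: n => [|n IHn]; first by rewrite !big_ord0 subr0.
rewrite !big_ord_recr /= mulrBr mulr1 opprD addrA lerB //.
by have /andP[? ?] := x01 n; have /andP[? ?] := P01 n; rewrite ler_piMl.
Qed.

Lemma qpochD a p m n : qpoch a p (m + n) = qpoch a p m * qpoch (a * p ^+ m) p n.
Proof.
rewrite /qpoch big_split_ord /=; congr (_ * _).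
by apply: eq_bigr => i _; rewrite exprD mulrA.
Qed.

Lemma norm_qpoch_le a p n : `|qpoch a p n| <= qpoch (- `|a|) `|p| n.
Proof.
rewrite normr_prod; apply: ler_prod => i _; rewrite normr_ge0 /=.
by rewrite mulNr opprK -normrX -normrM (le_trans (ler_normB _ _)) // normr1.
Qed.

Lemma qpoch_norm_ge0 a p n : `|a| <= 1 -> `|p| <= 1 -> 0 <= qpoch `|a| `|p| n.
Proof.
move=> a1 p1; apply: prodr_ge0 => i _; rewrite subr_ge0 mulr_ile1 ?exprn_ge0 //.
exact: exprn_ile1.
Qed.

Lemma norm_qpoch_ge a p n : `|a| <= 1 -> `|p| <= 1 ->
  qpoch `|a| `|p| n <= `|qpoch a p n|.
Proof.
move=> a1 p1; rewrite normr_prod; apply: ler_prod => i _.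
rewrite subr_ge0 mulr_ile1 ?exprn_ge0 ?exprn_ile1 //=.
by rewrite -normrX -normrM (le_trans _ (lerB_dist _ _)) // normr1.
Qed.

Lemma nonunity_norm_lt1 p : `|p| < 1 -> nonunity p.
Proof.
move=> p1 n; rewrite subr_eq0; apply: contraTneq p1 => /(congr1 Num.norm).
rewrite normr1 normrX => E; apply/negP => p1.
by have := exprn_ilt1 n.+1 (normr_ge0 p) p1; rewrite -E ltxx.
Qed.

Lemma norm_qpochV_le a p n : `|a| < 1 -> `|p| <= 1 ->
  `|(qpoch a p n)^-1| <= (qpoch `|a| `|p| n)^-1.
Proof.
move=> a1 p1; have g0 : 0 < qpoch `|a| `|p| n.
  apply: prodr_gt0 => i _; rewrite subr_gt0.
  by rewrite (le_lt_trans _ a1) // ler_piMr // exprn_ile1.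
have le := norm_qpoch_ge n (ltW a1) p1.
by rewrite normfV lef_pV2 // posrE (lt_le_trans g0).
Qed.

Lemma norm_qfac_le p n : `|p| < 1 -> `|qfac p n| <= qfac `|p| n.
Proof. by move=> p1; apply: norm_qpochV_le => //; exact: ltW. Qed.

(* A numFieldType is neither archimedean nor complete: what is needed of both is
   assumed here, and proved for R[i] in [complex_geo] and [complex_geo_cauchy]. *)
Hypothesis geo : forall x, `|x| < 1 -> x ^+ n @[n --> \oo] --> (0 : K).

Lemma geo_lt x e : 0 <= x -> x < 1 -> 0 < e -> exists N, x ^+ N < e.
Proof.
move=> x0 x1 e0; have /geo : `|x| < 1 by rewrite ger0_norm.
move=> /cvgr0Pnorm_lt /(_ e e0) [N _ /(_ N (leqnn N))] /=.
by rewrite normrX ger0_norm // => ?; exists N.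
Qed.

(* Weierstrass' inequality makes the product beyond N at least 1/2. *)
Lemma qpoch_tail_ge a p : 0 <= a -> 0 <= p -> p < 1 ->
  exists N, a * p ^+ N <= 1 /\ forall n, 2^-1 <= qpoch (a * p ^+ N) p n.
Proof.
move=> a0 p0 p1; have p10 : 0 < 1 - p by rewrite subr_gt0.
have a10 : 0 < a + 1 by rewrite ltr_wpDl.
(* N makes the geometric sum a p^N / (1 - p) at most 1/2; a + 1 keeps the divisor positive when a =
   0. *)
have [|N ltN] := @geo_lt p ((1 - p) / (2 * (a + 1))) p0 p1.
  by rewrite divr_gt0 // mulr_gt0.
have aN : a * p ^+ N / (1 - p) <= 2^-1.
  rewrite ler_pdivrMr //; apply: (@le_trans _ _ ((a + 1) * p ^+ N)).
    by rewrite ler_wpM2r ?exprn_ge0 // lerDl.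
  rewrite mulrC -ler_pdivlMr // (le_trans (ltW ltN)) // invfM mulrA.
  by rewrite [_ * 2^-1]mulrC.
have aN1 : a * p ^+ N <= 1.
  rewrite (@le_trans _ _ (a * p ^+ N / (1 - p))) //; last first.
    by rewrite (le_trans aN) // invf_le1 // ler1n.
  rewrite ler_peMr ?mulr_ge0 ?exprn_ge0 // invf_ge1 // gerBl //.
exists N; split=> // n.
apply: le_trans (prod_1B_ge (x := fun i => a * p ^+ N * p ^+ i) _ _); last first.
  move=> i; rewrite !mulr_ge0 ?exprn_ge0 //= mulr_ile1 ?mulr_ge0 ?exprn_ge0 //.
  by rewrite exprn_ile1 // ltW.
rewrite -mulr_sumr lerBrDr -lerBrDl.
have -> : 1 - 2^-1 = 2^-1 :> K by rewrite {1}(splitr 1) !mul1r addrK.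
apply: le_trans aN; rewrite ler_wpM2l ?mulr_ge0 ?exprn_ge0 //.
exact: sum_geo_le.
Qed.

(** Beyond N, with b = |a| |p|^N, the product of (1 + b |p|^i) (1 - b |p|^i) is at most 1, so a
    lower bound 1/2 for (b; |p|)_n bounds (-b; |p|)_n by 2. *)
Lemma qpoch_bounded a p : `|p| < 1 -> exists2 D, 0 < D & forall n, `|qpoch a p n| <= D.
Proof.
move=> p1; have [N [aN1 aN]] := qpoch_tail_ge (normr_ge0 a) (normr_ge0 p) p1.
have M1 c n : 0 <= c -> 1 <= qpoch (- c) `|p| n.
  move=> c0; elim: n => [|n IHn]; first by rewrite qpoch0.
  by rewrite qpochS mulr_ege1 // mulNr opprK lerDl mulr_ge0 // exprn_ge0.
exists (qpoch (- `|a|) `|p| N * 2) => [|n].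
  by rewrite mulr_gt0 // (lt_le_trans ltr01) // M1.
apply: le_trans (norm_qpoch_le _ _ _) _.
apply: (@le_trans _ _ (qpoch (- `|a|) `|p| (n + N))).
  rewrite qpochD mulNr ler_peMr ?M1 ?mulr_ge0 ?exprn_ge0 //.
  by rewrite (le_trans ler01) ?M1.
rewrite addnC qpochD ler_wpM2l ?(le_trans ler01) ?M1 //.
set b := `|a| * `|p| ^+ N in aN aN1 *; rewrite mulNr.
have b0 : 0 <= b by rewrite mulr_ge0 // exprn_ge0.
have : qpoch (- b) `|p| n * qpoch b `|p| n <= 1.
  rewrite -big_split /=; apply: prodr_ile1 => i.
  have c0 : 0 <= b * `|p| ^+ i by rewrite mulr_ge0 // exprn_ge0.
  have c1 : b * `|p| ^+ i <= 1 by rewrite mulr_ile1 ?exprn_ge0 // exprn_ile1 // ltW.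
  rewrite mulNr opprK mulrC -subr_sqr expr1n subr_ge0 gerBl exprn_ge0 // andbT.
  by rewrite exprn_ile1.
have := aN n; have := M1 b n b0; set u := qpoch (- b) _ n; set v := qpoch b _ n.
move=> u1 v2 uv; rewrite -[leRHS]mul1r -ler_pdivrMr //; apply: le_trans uv.
by rewrite ler_wpM2l // (le_trans ler01).
Qed.

(** Over |p| the products decrease in n, hence (|p|; |p|)_n >= (|p|; |p|)_(N+n) >= (|p|; |p|)_N /
    2. *)
Lemma qfac_bounded p : `|p| < 1 -> exists2 D, 0 < D & forall n, `|qfac p n| <= D.
Proof.
move=> p1; have [N [aN1 aN]] := qpoch_tail_ge (normr_ge0 p) (normr_ge0 p) p1.
have np : nonunity `|p| by apply: nonunity_norm_lt1; rewrite normr_id.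
have p1' := ltW p1.
have g0 n : 0 < qpoch `|p| `|p| n by rewrite lt0r qpoch_neq0 // qpoch_norm_ge0.
have half0 : 0 < 2^-1 :> K by rewrite invr_gt0.
exists (qpoch `|p| `|p| N * 2^-1)^-1 => [|n].
  by rewrite invr_gt0 mulr_gt0.
apply: le_trans (norm_qfac_le _ p1) _; rewrite lef_pV2 ?posrE ?mulr_gt0 //.
apply: (@le_trans _ _ (qpoch `|p| `|p| (N + n))).
  by rewrite qpochD ler_wpM2l // ltW.
rewrite addnC qpochD ler_piMr ?(ltW (g0 _)) //.
apply: prodr_ile1 => i; rewrite subr_ge0 gerBl !mulr_ge0 ?exprn_ge0 // andbT.
by rewrite -exprS -exprD exprn_ile1.
Qed.

End Bounds.

(** * Convergence of q-Pochhammer symbols and Tannery's theorem *)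

Section Limits.
Variable K : numFieldType.
Implicit Types (a p q x : K).
Hypothesis geo : forall x, `|x| < 1 -> x ^+ n @[n --> \oo] --> (0 : K).
Hypothesis geo_cauchy : forall (u : nat -> K) c x, 0 <= x -> x < 1 ->
  (forall n, `|u n.+1 - u n| <= c * x ^+ n) -> cvg (u n @[n --> \oo]).

(** Consecutive products differ by -a p^n (a; p)_n, which is geometrically small. *)
Lemma cvg_qpoch a p : `|p| < 1 -> qpoch a p n @[n --> \oo] --> qpoch_inf a p.
Proof.
move=> p1; have [D D0 qD] := qpoch_bounded geo a p1.
apply: (geo_cauchy (c := D * `|a|) (x := `|p|)) => // n.
rewrite qpochS mulrBr mulr1 addrAC subrr add0r normrN !normrM normrX mulrA.
by rewrite !ler_wpM2r ?exprn_ge0.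
Qed.

(** A zero limit would make the reciprocals [qfac p n] unbounded. *)
Lemma qpoch_inf_neq0 p : `|p| < 1 -> qpoch_inf p p != 0.
Proof.
move=> p1; have [D D0 qD] := qfac_bounded geo p1.
have np := nonunity_norm_lt1 p1.
apply/eqP => E; have := cvg_qpoch (a := p) p1; rewrite E.
move=> /cvgr0Pnorm_lt /(_ D^-1); rewrite invr_gt0 => /(_ D0) [N _ /(_ N (leqnn N))] /=.
apply/negP; rewrite -real_leNgt ?normr_real ?gtr0_real ?invr_gt0 //.
rewrite -[leRHS]invrK lef_pV2 ?posrE ?invr_gt0 ?normr_gt0 ?qpoch_neq0 //.
by rewrite -normfV; exact: qD.
Qed.

Lemma cvg_qfac p : `|p| < 1 -> qfac p n @[n --> \oo] --> (qpoch_inf p p)^-1.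
Proof.
by move=> p1; apply: cvgV; [exact: qpoch_inf_neq0|exact: cvg_qpoch].
Qed.

(** Dominated convergence, stated for a difference so that convergence of the sum of [w] is not
    presupposed: it can be deduced from the weighted sums. *)
Lemma tannery (w : nat -> K) (b : nat -> nat -> K) (l c x D : K) :
  0 <= c -> 0 <= x -> x < 1 -> (forall i, `|w i| <= c * x ^+ i) ->
  (forall k i, `|b k i - l| <= D) -> (forall i, b k i @[k --> \oo] --> l) ->
  (\sum_(i < k.+1) w i * b k i) - l * (\sum_(i < k.+1) w i) @[k --> \oo] --> (0 : K).
Proof.
move=> c0 x0 x1 wc bD bl; have x10 : 0 < 1 - x by rewrite subr_gt0.
have D0 : 0 <= D by exact: le_trans (bD 0%N 0%N).
apply/cvgr0Pnorm_lt => e e0.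
have e2 : 0 < e / 2 by rewrite divr_gt0.
have cD : 0 < c * D + 1 by rewrite ltr_wpDl // mulr_ge0.
(* N brings the tail bound c D x^N / (1 - x) below e/2; the added 1 keeps the divisor positive. *)
have [|N xN] := geo_lt geo (e := (e / 2) * (1 - x) / (c * D + 1)) x0 x1.
  by rewrite divr_gt0 // mulr_gt0.
have head : \sum_(i < N) `|w i| * `|b k i - l| @[k --> \oo] --> (0 : K).
  elim: N {xN} => [|N IHN].
    by under eq_fun do rewrite big_ord0; exact: cvg_cst.
  under eq_fun do rewrite big_ord_recr /=.
  have bN : `|b k N - l| @[k --> \oo] --> (0 : K).
    apply: (norm_cvg0P _).2; rewrite -(subrr l).
    by apply: cvgB; [exact: bl|exact: cvg_cst].
  have := cvgD IHN (cvgM (cvg_cst `|w N|) bN); rewrite mulr0 addr0; exact.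
have /cvgr0Pnorm_lt /(_ _ e2) := head.
apply: filterS2 (nbhs_infty_ge N) => k leNk; rewrite ger0_norm; last first.
  by apply: sumr_ge0 => i _; rewrite mulr_ge0.
move=> hd; rewrite mulr_sumr -sumrB.
apply: le_lt_trans (ler_norm_sum _ _ _) _.
rewrite -(big_mkord xpredT (fun i => `|w i * b k i - l * w i|)).
rewrite (big_cat_nat (n := N)) ?leqW //= (splitr e) ltr_leD //.
  rewrite big_mkord; apply: le_lt_trans hd; apply: ler_sum => i _.
  by rewrite mulrC -mulrBl normrM mulrC.
rewrite -{1}[N]add0n big_addn big_mkord.
apply: (@le_trans _ _ (c * D * x ^+ N * \sum_(i < k.+1 - N) x ^+ i)).
  rewrite mulr_sumr; apply: ler_sum => i _.
  rewrite mulrC -mulrBl normrM [_ * D]mulrC -!mulrA -exprD addnC.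
  by rewrite ler_pM.
apply: le_trans (ler_wpM2l _ (sum_geo_le _ x0 x1)) _.
  by rewrite !mulr_ge0 // exprn_ge0.
rewrite ler_pdivrMr //.
move: xN; rewrite ltr_pdivlMr // => /ltW; apply: le_trans.
by rewrite mulrC ler_wpM2l ?exprn_ge0 // lerDl.
Qed.

End Limits.

(** What a finite J containing [E N] adds to the sum over [E N] is bounded by the sum of [g] over
    [E M] minus [E N], for some [E M] containing J. One e/3 serves [u], two serve the Cauchy
    difference for [g]. *)
Lemma has_sum_exhaustion (K : numFieldType) (I : choiceType) (u g : I -> K)
    (E : nat -> seq I) (s t : K) :
  (forall k, uniq (E k)) -> (forall k l, (k <= l)%N -> {subset E k <= E l}) ->
  (forall x, exists k, x \in E k) -> (forall x, `|u x| <= g x) ->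
  \sum_(x <- E k) u x @[k --> \oo] --> s ->
  \sum_(x <- E k) g x @[k --> \oo] --> t ->
  has_sum u s.
Proof.
move=> Eu Em Ex ug us gt; have FF := @totally_filter I.
apply/cvgrPdist_lt => e e0.
have e3 : 0 < e / 3 by rewrite divr_gt0.
have /cvgrPdist_lt /(_ _ e3) [N1 _ H1] := us.
have /cvgrPdist_lt /(_ _ e3) [N2 _ H2] := gt.
pose N := maxn N1 N2.
exists [fset x in E N]%fset => // J /fsubsetP subJ.
have [M leNM JM] : exists2 M, (N <= M)%N & {subset J <= E M}.
  suff [M JM] : exists M, {subset enum_fset J <= E M}.
    exists (maxn N M); first exact: leq_maxl.
    by move=> x /JM; apply: Em; exact: leq_maxr.
  elim: (enum_fset J) => [|x r [M IHr]]; first by exists 0%N.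
  have [k xk] := Ex x; exists (maxn k M) => y; rewrite in_cons => /orP[/eqP ->|yr].
    by apply: Em xk; exact: leq_maxl.
  by apply: (Em M); [exact: leq_maxr|exact: IHr].
have g0 x : 0 <= g x by exact: le_trans (ug x).
have -> : partial_sum u J = \sum_(x <- J) u x.
  by rewrite /partial_sum big_seq_fsetE.
have split_sum (h : I -> K) (r : seq I) : uniq r -> {subset E N <= r} ->
    \sum_(x <- r) h x = \sum_(x <- E N) h x + \sum_(x <- r | x \notin E N) h x.
  move=> ur sub; rewrite (bigID (mem (E N))) /=; congr (_ + _).
  rewrite -big_filter; apply: perm_big; apply: uniq_perm; rewrite ?filter_uniq //.
  by move=> x; rewrite mem_filter; case: (boolP (x \in E N)) => // /sub.
rewrite (split_sum u J) ?fset_uniq //; last by move=> x xN; apply: subJ; rewrite inE.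
rewrite opprD addrA; apply: le_lt_trans (ler_normB _ _) _.
have -> : e = e / 3 + (e / 3 + e / 3) by field.
apply: ltrD; first by apply: H1; rewrite /= leq_maxl.
apply: le_lt_trans (ler_norm_sum _ _ _) _.
apply: (@le_lt_trans _ _ (\sum_(x <- E M | x \notin E N) g x)).
  apply: (@le_trans _ _ (\sum_(x <- J | x \notin E N) g x)).
    by apply: ler_sum => x _.
  rewrite [leRHS](bigID (mem J)) /=.
  have -> : \sum_(x <- E M | (x \notin E N) && (x \in J)) g x = \sum_(x <- J | x \notin E N) g x.
    rewrite -big_filter -[in RHS]big_filter; apply: perm_big.
    apply: uniq_perm; rewrite ?filter_uniq ?fset_uniq //.
    move=> x; rewrite !mem_filter; case: (x \in E N) => //=.
    by case: (boolP (x \in J)) => // /JM ->.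
  by rewrite lerDl sumr_ge0.
have S0 : 0 <= \sum_(x <- E M | x \notin E N) g x by rewrite sumr_ge0.
rewrite -(ger0_norm S0).
have := split_sum g (E M) (Eu M) (Em _ _ leNM).
move=> /(canLR (addKr _)) <-; rewrite addrC.
have -> : \sum_(x <- E M) g x - \sum_(x <- E N) g x =
   (t - \sum_(x <- E N) g x) - (t - \sum_(x <- E M) g x) by ring.
apply: le_lt_trans (ler_normB _ _) _; apply: ltrD; apply: H2 => /=.
  by rewrite leq_maxr.
by rewrite (leq_trans _ leNM) // leq_maxr.
Qed.

(** * Evaluation of the sum *)

Section Evaluation.
Variable K : numFieldType.
Implicit Types (p q x : K).
Hypothesis geo : forall x, `|x| < 1 -> x ^+ n @[n --> \oo] --> (0 : K).
Hypothesis geo_cauchy : forall (u : nat -> K) c x, 0 <= x -> x < 1 ->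
  (forall n, `|u n.+1 - u n| <= c * x ^+ n) -> cvg (u n @[n --> \oo]).

Lemma norm_exprn_le q m n : `|q| < 1 -> (m <= n)%N -> `|q ^+ n| <= `|q| ^+ m.
Proof. by move=> q1 mn; rewrite normrX ler_wiXn2l // ltW. Qed.

Lemma norm_exprn_lt1 q n : `|q| < 1 -> (0 < n)%N -> `|q ^+ n| < 1.
Proof. by move=> q1 n0; rewrite normrX exprn_ilt1 // -lt0n. Qed.

(** For a >= 2 both exponents a r^2 + r and a r^2 - r are at least r. *)
Lemma norm_theta_term_le q a r : `|q| < 1 -> (2 <= a)%N ->
  `|theta_term q a r| <= 2 * `|q| ^+ r.
Proof.
move=> q1 a2; case: r => [|r]; first by rewrite normr1 expr0 mulr1 ler1n.
rewrite mulr2n mulrDl mul1r (le_trans (ler_normD _ _)) // lerD //.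
  by apply: norm_exprn_le => //; rewrite leq_addl.
by apply: norm_exprn_le => //; nia.
Qed.

Definition theta_sum q a k : K := \sum_(r < k.+1) theta_term q a r.

Lemma bailey_theta_sum p q a : `|p| < 1 -> `|q| < 1 -> (2 <= a)%N ->
  bailey p (theta_term q a) k - (qpoch_inf p p)^-1 ^+ 2 * theta_sum q a k
    @[k --> \oo] --> (0 : K).
Proof.
move=> p1 q1 a2; have [E E0 qE] := qfac_bounded geo p1.
set l := (qpoch_inf p p)^-1 ^+ 2.
have := @tannery _ geo (theta_term q a) (fun k r => qfac p (k - r) * qfac p (k + r)) l 2 `|q|
  (E * E + `|l|).
have -> : (fun k => \sum_(r < k.+1) theta_term q a r * (qfac p (k - r) * qfac p (k + r))
    - l * \sum_(r < k.+1) theta_term q a r) =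
  (fun k => bailey p (theta_term q a) k - l * theta_sum q a k).
  apply/funext => k; congr (_ - _); apply: eq_bigr => r _; exact: mulrA.
apply => //.
- by move=> r; exact: norm_theta_term_le.
- move=> k r; rewrite (le_trans (ler_normB _ _)) // lerD2r normrM.
  by rewrite ler_pM.
- move=> r; rewrite /l expr2; apply: cvgM.
    by rewrite (cvg_centern r (qfac p)); exact: (cvg_qfac geo geo_cauchy).
  by rewrite (cvg_shiftn r (qfac p)); exact: (cvg_qfac geo geo_cauchy).
Qed.

Lemma eq1_cvgn (u v : nat -> K) (l : K) : u =1 v ->
  u k @[k --> \oo] --> l -> v k @[k --> \oo] --> l.
Proof. by move=> /funext ->. Qed.

Lemma cvg_diff0 (u v : nat -> K) (l : K) :
  u k - v k @[k --> \oo] --> (0 : K) -> v k @[k --> \oo] --> l -> u k @[k --> \oo] --> l.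
Proof.
move=> uv vl; have := cvgD uv vl; rewrite add0r.
have E : (fun k => u k - v k) + v = u by apply/funext => k; exact: subrK.
by move: E => -> ; exact.
Qed.

Definition theta_prod q a : K :=
  qpoch_inf (q ^+ (2 * a)) (q ^+ (2 * a)) * qpoch_inf (- q ^+ a.-1) (q ^+ (2 * a))
  * qpoch_inf (- q ^+ a.+1) (q ^+ (2 * a)).

(** [finite_jacobi] gives the limit of the Bailey sums, and [bailey_theta_sum] says that they
    approach L^-2 times the theta sums, where L = (P; P)_oo. *)
Lemma jacobi_triple q a : q != 0 -> `|q| < 1 -> (2 <= a)%N ->
  theta_sum q a k @[k --> \oo] --> theta_prod q a.
Proof.
move=> q0 q1 a2; set P := q ^+ (2 * a).
have P1 : `|P| < 1 by apply: norm_exprn_lt1 => //; lia.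
have L0 := qpoch_inf_neq0 geo geo_cauchy P1.
set L := qpoch_inf P P in L0 *.
have nq := nonunity_norm_lt1 q1.
have bl : bailey P (theta_term q a) k @[k --> \oo] -->
    qpoch_inf (- q ^+ a.+1) P * qpoch_inf (- q ^+ a.-1) P * L^-1.
  have -> : bailey P (theta_term q a) = fun k =>
      qpoch (- q ^+ a.+1) P k * qpoch (- q ^+ a.-1) P k * qfac P (2 * k).
    by apply/funext => k; rewrite finite_jacobi // ltnW.
  apply: cvgM; first by apply: cvgM; exact: cvg_qpoch.
  have c2 : (2 * k)%N @[k --> \oo] --> \oo.
    by move=> A [N _ NA]; exists N => // k /= Nk; apply: NA => /=; lia.
  exact: (@cvg_comp _ _ _ (fun k => (2 * k)%N) (qfac P) _ _ _ c2 (cvg_qfac geo geo_cauchy P1)).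
have H : L ^+ 2 * (L^-1 ^+ 2 * theta_sum q a k) @[k --> \oo] -->
    L ^+ 2 * (qpoch_inf (- q ^+ a.+1) P * qpoch_inf (- q ^+ a.-1) P * L^-1).
  apply: cvgM; first exact: cvg_cst.
  apply: cvg_diff0 bl.
  have := cvgN (bailey_theta_sum P1 q1 a2); rewrite oppr0.
  have E1 : - (fun k => bailey P (theta_term q a) k - L^-1 ^+ 2 * theta_sum q a k)
    = (fun k => L^-1 ^+ 2 * theta_sum q a k - bailey P (theta_term q a) k).
    by apply/funext => k; exact: opprB.
  by move: E1 => ->; exact.
have -> : theta_prod q a =
  L ^+ 2 * (qpoch_inf (- q ^+ a.+1) P * qpoch_inf (- q ^+ a.-1) P * L^-1).
  by rewrite /theta_prod -/P -/L; field.
apply: eq1_cvgn H => k; rewrite mulrA -exprMn divff //.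
by rewrite expr1n mul1r.
Qed.

Lemma bailey_bounded p q a : `|p| < 1 -> `|q| < 1 -> (2 <= a)%N ->
  exists2 D, 0 <= D & forall k, `|bailey p (theta_term q a) k| <= D.
Proof.
move=> p1 q1 a2; have [E E0 qE] := qfac_bounded geo p1.
have q10 : 0 < 1 - `|q| by rewrite subr_gt0.
exists (2 * E ^+ 2 * (1 - `|q|)^-1) => [|k].
  by rewrite !mulr_ge0 ?exprn_ge0 ?invr_ge0 // ltW.
apply: le_trans (ler_norm_sum _ _ _) _.
apply: (@le_trans _ _ (2 * E ^+ 2 * \sum_(r < k.+1) `|q| ^+ r)).
  rewrite mulr_sumr; apply: ler_sum => r _; rewrite !normrM.
  have -> : 2 * E ^+ 2 * `|q| ^+ r = (2 * `|q| ^+ r) * E * E by ring.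
  by rewrite !ler_pM ?mulr_ge0 ?exprn_ge0 // norm_theta_term_le.
by rewrite ler_wpM2l ?mulr_ge0 ?exprn_ge0 ?(ltW E0) // sum_geo_le.
Qed.

(** The sum over M is Bailey step f + 1 without its factor 1/(p; p)_(k-M), which tends to 1/L with L
    = (p; p)_oo. By Tannery, 1/L times this sum has the same limit as that Bailey sum, namely L^-2
    times the theta product. *)
Lemma cvg_bailey_chain q f : q != 0 -> `|q| < 1 ->
  \sum_(M < k.+1) (q ^+ 3) ^+ (M ^ 2)
    * iter f (bailey_next (q ^+ 3)) (bailey (q ^+ 3) (theta_term q 3)) M
  @[k --> \oo] --> theta_prod q (3 * f.+1 + 3) / qpoch_inf (q ^+ 3) (q ^+ 3).
Proof.
move=> q0 q1; set p := q ^+ 3.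
have p1 : `|p| < 1 by exact: norm_exprn_lt1.
have np := nonunity_norm_lt1 p1.
have L0 := qpoch_inf_neq0 geo geo_cauchy p1.
set L := qpoch_inf p p in L0 *.
(* The theta exponent starts at 3 and each step in base q^3 adds 3: [a] is its value after f steps,
   [a'] after f + 1. *)
pose a := (3 * f + 3)%N; pose a' := (3 * f.+1 + 3)%N.
have a2 : (2 <= a)%N by rewrite /a; lia.
have a2' : (2 <= a')%N by rewrite /a'; lia.
have chainE j M : iter j (bailey_next p) (bailey p (theta_term q 3)) M =
    bailey p (theta_term q (3 * j + 3)) M.
  rewrite bailey_iter //; apply: eq_bailey => r.
  by rewrite -[RHS]theta_termM // /p -!exprM mulnA.
pose B M := p ^+ (M ^ 2) * bailey p (theta_term q a) M.
have -> : (fun k => \sum_(M < k.+1) p ^+ (M ^ 2) *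
    iter f (bailey_next p) (bailey p (theta_term q 3)) M) = fun k => \sum_(M < k.+1) B M.
  by apply/funext => k; apply: eq_bigr => M _; rewrite chainE.
have [D D0 bD] := bailey_bounded p1 q1 a2.
have [E E0 qE] := qfac_bounded geo p1.
have BD M : `|B M| <= D * `|p| ^+ M.
  rewrite normrM mulrC ler_pM ?norm_exprn_le //; nia.
have T := @tannery _ geo B (fun k M => qfac p (k - M)) L^-1 D `|p| (E + `|L^-1|) D0
  (normr_ge0 _) p1 BD.
have {}T : bailey p (theta_term q a') k - L^-1 * \sum_(M < k.+1) B M @[k --> \oo] --> (0 : K).
  have -> : (fun k => bailey p (theta_term q a') k - L^-1 * \sum_(M < k.+1) B M) =
    (fun k => \sum_(M < k.+1) B M * qfac p (k - M) - L^-1 * \sum_(M < k.+1) B M).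
    apply/funext => k; congr (_ - _); rewrite /a' -chainE iterS.
    by apply: eq_bigr => M _; rewrite chainE mulrAC.
  apply: T => [k M|M].
    by rewrite (le_trans (ler_normB _ _)) // lerD2r.
  by rewrite (cvg_centern M (qfac p)); exact: (cvg_qfac geo geo_cauchy).
have Bl : bailey p (theta_term q a') k @[k --> \oo] --> L^-1 ^+ 2 * theta_prod q a'.
  apply: cvg_diff0 (bailey_theta_sum p1 q1 a2') _.
  by apply: cvgM; [exact: cvg_cst|exact: jacobi_triple].
have H : L * (L^-1 * \sum_(M < k.+1) B M) @[k --> \oo] --> L * (L^-1 ^+ 2 * theta_prod q a').
  apply: cvgM; first exact: cvg_cst.
  apply: cvg_diff0 Bl; have := cvgN T; rewrite oppr0.
  have E1 : - (fun k => bailey p (theta_term q a') k - L^-1 * \sum_(M < k.+1) B M)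
    = (fun k => L^-1 * \sum_(M < k.+1) B M - bailey p (theta_term q a') k).
    by apply/funext => k; exact: opprB.
  by move: E1 => ->; exact.
have -> : theta_prod q a' / L = L * (L^-1 ^+ 2 * theta_prod q a') by field.
by apply: eq1_cvgn H => k; rewrite mulVKf.
Qed.

Lemma cvg_box_sum (r : K) f : r != 0 -> `|r| < 1 -> let q := r ^+ 2 in
  \sum_(x <- box f.+1 k) (let: (m, n, ns) := x in summand ns q m n) @[k --> \oo] -->
  qpochs_inf [:: q ^+ (6 * f.+1 + 6); - q ^+ (3 * f.+1 + 2); - q ^+ (3 * f.+1 + 4)]
    (q ^+ (6 * f.+1 + 6)) / qpoch_inf (q ^+ 3) (q ^+ 3).
Proof.
move=> r0 r1 q; have q0 : q != 0 by rewrite expf_neq0.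
have q1 : `|q| < 1 by exact: norm_exprn_lt1.
have -> : qpochs_inf [:: q ^+ (6 * f.+1 + 6); - q ^+ (3 * f.+1 + 2);
    - q ^+ (3 * f.+1 + 4)] (q ^+ (6 * f.+1 + 6)) = theta_prod q (3 * f.+1 + 3).
  rewrite /qpochs_inf /theta_prod !big_cons big_nil mulr1 mulrA.
  have -> : (2 * (3 * f.+1 + 3) = 6 * f.+1 + 6)%N by lia.
  have -> : (3 * f.+1 + 3).-1 = (3 * f.+1 + 2)%N by lia.
  by have -> : (3 * f.+1 + 3).+1 = (3 * f.+1 + 4)%N by lia.
apply: eq1_cvgn (@cvg_bailey_chain q f q0 q1) => k.
rewrite sum_box /q -exprM; apply: eq_bigr => M _; congr (_ * _).
have nr := nonunity_norm_lt1 r1.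
by congr (iter _ _ _ _); apply/funext => N; rewrite cap_bailey.
Qed.

End Evaluation.

(** * Domination of the summand by its value at |q| *)

Section NormBound.
Variable K : numFieldType.

Lemma norm_summand_le f (t : f.-tuple nat) (q : K) m n : `|q| < 1 ->
  `|summand t q m n| <= summand t `|q| m n.
Proof.
move=> q1; have q1' := ltW q1.
have Q1 : `|q ^+ 3| < 1 by exact: norm_exprn_lt1.
(* The numerator (p; p)_N, N = n_f, is not dominated by its value at |q|. Cancelling it against (p;
   p)_2N leaves 1/(p^(N+1); p)_N, so only powers and reciprocals remain to be bounded. *)
pose F (x : K) := x ^+ (2 * m ^ 2 + 6 * m * n + 6 * n ^ 2 +
    3 * \sum_(1 <= i < f.+1) tail_sum t i ^ 2)%N *
  (qpoch (x ^+ 3 * x ^+ 3 ^+ entry t f) (x ^+ 3) (entry t f))^-1 *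
  qpochV (x ^+ 3) (x ^+ 3) ((entry t f)%:Z - 2 * n%:Z - m%:Z) *
  (qpoch x x m)^-1 * (qpoch (x ^+ 3) (x ^+ 3) n)^-1 *
  \prod_(1 <= i < f) (qpoch (x ^+ 3) (x ^+ 3) (entry t i))^-1.
have FE x : `|x| < 1 -> summand t x m n = F x.
  move=> x1; have X1 : `|x ^+ 3| < 1 by exact: norm_exprn_lt1.
  have nX := nonunity_norm_lt1 X1.
  rewrite /F /summand prodfV [(2 * entry t f)%N]mul2n -addnn qpochD !invfM.
  have := qpoch_neq0 (entry t f) nX; set u := qpoch _ _ _; move=> u0.
  by rewrite -[RHS]mul1r -(divff u0); ring.
rewrite (FE _ q1) (FE `|q|) ?normr_id // /F.
have NM (x y c d : K) : `|x| <= c -> `|y| <= d -> `|x * y| <= c * d.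
  by move=> xc yd; rewrite normrM ler_pM.
have W N : `|(qpoch (q ^+ 3) (q ^+ 3) N)^-1| <= (qpoch (`|q| ^+ 3) (`|q| ^+ 3) N)^-1.
  by rewrite -normrX norm_qpochV_le // ltW.
apply: (NM); last first.
  rewrite normr_prod; apply: ler_prod => i _; rewrite normr_ge0; exact: W.
apply: (NM); last exact: W.
apply: (NM); last exact: norm_qpochV_le.
apply: (NM); last by rewrite !qpochV_sub; case: ifP => _; [exact: W|rewrite normr0].
apply: (NM); first by rewrite normrX.
rewrite -!normrX -normrM; apply: norm_qpochV_le; last exact: ltW.
by rewrite -exprS norm_exprn_lt1.
Qed.

End NormBound.

(** * Geometric convergence in the complex numbers *)

Section Complex.
Variable R : realType.
Local Open Scope complex_scope.
Local Notation Re := (@complex.Re R).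
Local Notation Im := (@complex.Im R).
Let C : numFieldType := R[i].
Implicit Types (x z : R[i]).

Lemma Re_normE z : `|z| = (Re `|z|)%:C.
Proof. by rewrite RRe_real // normr_real. Qed.

Lemma norm_i : `|'i| = 1 :> R[i].
Proof. by rewrite normc_def /= expr0n expr1n add0r sqrtr1. Qed.

Lemma norm_Re_le z : `|Re z| <= Re `|z|.
Proof. by rewrite -lecR -Re_normE normc_ge_Re. Qed.

Lemma norm_Im_le z : `|Im z| <= Re `|z|.
Proof.
by have := norm_Re_le (z * 'i); rewrite normrM norm_i mulr1 ReiNIm normrN.
Qed.

Lemma normc_le_ReIm z : Re `|z| <= `|Re z| + `|Im z|.
Proof.
rewrite -lecR -Re_normE {1}(complexE z) (le_trans (ler_normD _ _)) //.
rewrite normrM norm_i mul1r rmorphD /= !normc_def /= expr0n /= !addr0 !sqrtr_sqr.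
exact: lexx.
Qed.

(** The modulus on [R[i]] has values in [R[i]]; this reduces convergence to real radii. *)
Lemma cvg_complex (u : nat -> R[i]) (l : R[i]) :
  (forall e : R, 0 < e -> \forall n \near \oo, Re `|l - u n| < e) ->
  (u n : C) @[n --> \oo] --> (l : C).
Proof.
move=> ul; apply/cvgrPdist_lt => e e0.
have E : (Re e)%:C = e by rewrite RRe_real // gtr0_real.
have : 0 < Re e by rewrite -ltcR E.
by move=> /ul; apply: filterS => n; rewrite -ltcR -Re_normE E.
Qed.

Lemma complex_geo (x : C) : `|x| < 1 -> x ^+ n @[n --> \oo] --> (0 : C).
Proof.
rewrite Re_normE (ltcR _ 1) => x1; apply: cvg_complex => e e0.
have x0 : 0 <= Re `|x| by rewrite -lecR -Re_normE; exact: normr_ge0.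
have /cvg_expr : `|Re `|x| | < 1 by rewrite ger0_norm.
move=> /cvgr0Pnorm_lt /(_ e e0); apply: filterS => n.
rewrite sub0r normrN normrX ger0_norm // => xn.
by rewrite normrX Re_normE -rmorphXn /=.
Qed.

(** Telescoping turns the sequence into a series dominated by a geometric one. *)
Lemma real_geo_cauchy (v : nat -> R) (c x : R) : 0 <= x -> x < 1 ->
  (forall n, `|v n.+1 - v n| <= c * x ^+ n) -> cvgn v.
Proof.
move=> x0 x1 vc.
have -> : v = (fun n => v 0%N + series (telescope v) n).
  by apply/funext => n; rewrite -eq_sum_telescope.
apply: is_cvgD; first exact: is_cvg_cst.
apply: normed_cvg; apply: (series_le_cvg _ _ vc) => [n|n|].
- exact: normr_ge0.
- exact: le_trans (vc n).
- by apply: is_cvg_geometric_series; rewrite ger0_norm.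
Qed.

Lemma complex_geo_cauchy (u : nat -> C) (c x : C) : 0 <= x -> x < 1 ->
  (forall n, `|u n.+1 - u n| <= c * x ^+ n) -> cvg (u n @[n --> \oo]).
Proof.
move=> x0 x1 uc.
have xE : (Re x)%:C = x by rewrite RRe_real // ger0_real.
have c0 : 0 <= c by have := uc 0%N; rewrite expr0 mulr1; exact: le_trans (normr_ge0 _).
have cE : (Re c)%:C = c by rewrite RRe_real // ger0_real.
have y0 : 0 <= Re x by rewrite -lecR xE.
have y1 : Re x < 1 by rewrite -ltcR xE.
have uc' n : Re `|u n.+1 - u n| <= Re c * Re x ^+ n.
  by rewrite -lecR -Re_normE rmorphM rmorphXn /= xE cE.
have /cvg_ex[/= a ua] : cvgn (fun n => Re (u n)).
  apply: (real_geo_cauchy y0 y1) => n; apply: le_trans (uc' n).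
  by apply: le_trans (norm_Re_le _); rewrite raddfB.
have /cvg_ex[/= b ub] : cvgn (fun n => Im (u n)).
  apply: (real_geo_cauchy y0 y1) => n; apply: le_trans (uc' n).
  by apply: le_trans (norm_Im_le _); rewrite raddfB.
suff ul : (u n : C) @[n --> \oo] --> (a +i* b : C) by exact: cvgP ul.
apply: cvg_complex => e e0.
have e2 : 0 < e / 2 by rewrite divr_gt0.
have /cvgrPdist_lt /(_ _ e2) Ha := ua; have /cvgrPdist_lt /(_ _ e2) Hb := ub.
apply: filterS2 Ha Hb => n Ha Hb; apply: le_lt_trans (normc_le_ReIm _) _.
by rewrite (splitr e) ltrD //; [move: Ha|move: Hb]; case: (u n).
Qed.

End Complex.

(** * The case q = 0 *)

Section ZeroBase.
Variable K : numFieldType.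

Lemma has_sum_point (I : choiceType) (u : I -> K) x0 :
  (forall x, x != x0 -> u x = 0) -> has_sum u (u x0).
Proof.
move=> u0; have FF := @totally_filter I.
apply/cvgrPdist_lt => e e0; exists [fset x0]%fset => // J.
rewrite /= fsub1set => x0J.
have -> : partial_sum u J = \sum_(x <- J) u x by rewrite /partial_sum big_seq_fsetE.
rewrite (bigD1_seq x0) ?fset_uniq //= big1 => [|x xx0]; last exact: u0.
by rewrite addr0 subrr normr0.
Qed.

Lemma qpoch_inf0 (p : K) : qpoch_inf 0 p = 1.
Proof.
rewrite /qpoch_inf; have -> : qpoch 0 p = (fun=> 1).
  by apply/funext => n; apply: big1 => i _; rewrite mul0r subr0.
by apply: cvg_lim; [exact: norm_hausdorff|exact: cvg_cst].
Qed.

(** Treated apart because the general argument cancels powers of q. As 0^0 = 1, only the index with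
    exponent 0 survives, and exponent 0 forces m = n = N_1 = 0. *)
Lemma has_sum_q0 f : (0 < f)%N ->
  has_sum (fun x : nat * nat * f.-tuple nat =>
    let: (m, n, ns) := x in summand ns (0 : K) m n) 1.
Proof.
move=> f0; pose t0 := [tuple of nseq f 0%N].
have e0 i : entry t0 i = 0%N by rewrite /entry nth_nseq if_same.
have t00 i : tail_sum t0 i = 0%N by apply: big1 => j _; rewrite e0.
have <- : summand t0 (0 : K) 0 0 = 1.
  rewrite /summand !e0 !muln0 /= !qpoch0 !big1 => [|i _|i _].
  - by rewrite /qpochV /= ?qpoch0 ?muln0 ?expr0 !mulr1 !invr1 !mulr1.
  - by rewrite e0 qpoch0.
  - by rewrite t00.
apply: (has_sum_point (u := fun x : nat * nat * f.-tuple nat =>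
    let: (m, n, ns) := x in summand ns (0 : K) m n) (x0 := (0%N, 0%N, t0))).
move=> [[m n] t] neq; rewrite /summand expr0n.
case: eqP => [E|]; last by rewrite !mul0r.
case/eqP: neq; have s0 : sumn t = 0%N.
  have : (tail_sum t 1 ^ 2 <= \sum_(1 <= i < f.+1) tail_sum t i ^ 2)%N.
    by rewrite big_ltn // leq_addr.
  have -> : (\sum_(1 <= i < f.+1) tail_sum t i ^ 2 = 0)%N by move: E; lia.
  by rewrite tail_sum1 leqn0 expn_eq0 => /andP[/eqP].
have -> : m = 0%N by move: E; case: m => // m; lia.
have -> : n = 0%N by move: E; case: n => // n; lia.
congr (_, _); apply: eq_from_tnth => i; rewrite [RHS](tnth_nth 0%N) nth_nseq if_same.
apply/eqP; rewrite -leqn0 -s0 sumnE (big_rem (tnth t i)) ?mem_tnth //=.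
exact: leq_addr.
Qed.

End ZeroBase.

(** * The identity for complex q *)

Local Open Scope complex_scope.

Theorem theorem15 (R : realType) (f : nat) (hf : (0 < f)%N)
    (q : R[i]) (hq : `|q| < 1) :
  has_sum
    (fun x : nat * nat * f.-tuple nat =>
       let: (m, n, ns) := x in summand ns q m n)
    (qpochs_inf
       [:: q ^+ (6 * f + 6); - q ^+ (3 * f + 2); - q ^+ (3 * f + 4)]
       (q ^+ (6 * f + 6))
     / qpoch_inf (q ^+ 3) (q ^+ 3)).
Proof.
have [q0|q0] := eqVneq q 0.
  have z m n : (0 : R[i]) ^+ (m + n.+1) = 0 by rewrite addnS exprS mul0r.
  have := @has_sum_q0 R[i] f hf; rewrite q0 /qpochs_inf !big_cons big_nil !z exprS mul0r.
  by rewrite oppr0 !qpoch_inf0 !mulr1 divr1.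
case: f hf => // f _.
(* The evaluation is in terms of a square root of the base; it is used both at q and at |q|, hence
   two roots. *)
have root (z : R[i]) : z != 0 -> `|z| < 1 -> exists r : R[i], [/\ r != 0, `|r| < 1 & r ^+ 2 = z].
  move=> z0 z1; exists (sqrtc z); rewrite sqrtc_eq0 sqr_sqrtc; split => //.
  by rewrite -(@expr_lt1 _ 2) // -normrX sqr_sqrtc.
have [r [r0 r1 rq]] := root q q0 hq.
have [s [s0 s1 sq]] : exists s : R[i], [/\ s != 0, `|s| < 1 & s ^+ 2 = `|q|].
  by apply: root; rewrite ?normr_eq0 ?normr_id.
have cq := cvg_box_sum (f := f) (@complex_geo R) (@complex_geo_cauchy R) r0 r1.
have cs := cvg_box_sum (f := f) (@complex_geo R) (@complex_geo_cauchy R) s0 s1.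
rewrite /= rq sq in cq cs.
(* [cs], the evaluation at |q|, shows that the dominating sums converge. *)
apply: (has_sum_exhaustion _ _ _ _ cq cs).
- exact: box_uniq.
- exact: box_sub.
- move=> [[m n] t]; exists (m + n + sumn t)%N; rewrite mem_box.
  by rewrite leq_addl -addnA leq_addr addnCA leq_addr.
- by move=> [[m n] t]; exact: norm_summand_le.
Qed.
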